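(* Let $\tau_{\mathrm{OGA}}$ be the stopping time of the online gradient ascent CuSum (OGA-CuSum) algorithm described in the context, run with threshold $c=\log\gamma$. Then $\mathbb{E}_\infty[\tau_{\mathrm{OGA}}]\ge\gamma$, where $\mathbb{E}_\infty$ is the expectation under the no-change measure $\mathbb{P}_\infty$, for which $\bm y_1,\bm y_2,\dots$ are i.i.d. $\mathcal N(\bm0,\bm I)$ in $\mathbb{R}^K$.
   Context: Setting. Observations $\bm y_t\in\mathbb{R}^K$ are i.i.d. $\mathcal N(\bm0,\bm I)$ with density $p_\infty$ before an unknown change time; after the change, $\bm y_t=\bm x_t+\bm\nu_t$ with $\bm\nu_t\sim\mathcal N(\bm0,\bm I)$ and an unobserved signal $\bm x_t=\bm A\bm x_{t-1}+\bm\omega_t$, $\bm\omega_t\sim\mathcal N(\bm0,\bm R_\omega)$, where $\bm A$ and $\bm R_\omega$ are unknown. $\gamma>0$ is the prescribed level for the average running length to false alarm. The function $h$. For $\bm A\in\mathbb{R}^{K\times K}$, positive definite $\bm R$ and $\bm\Sigma$, and $\bm\mu,\bm y\in\mathbb{R}^K$, put $\bm M=\bm A\bm\Sigma\bm A^\top+\bm R$, $\bm v=(\bm M+\bm I)(\bm\mu-\bm\Sigma\bm y)$, and $$H(\bm A,\bm R,\bm\Sigma;\bm\mu,\bm y)=\log\Big(\frac{1}{\sqrt{(2\pi)^K\det\bm M}}\cdot\frac{1}{\sqrt{\det(\bm M^{-1}+\bm I)}}\Big)-\frac12\Big(\bm v^\top\bm M^{-1}\bm v+\bm y^\top\bm y-(\bm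 M^{-1}\bm v+\bm y)^\top(\bm M^{-1}+\bm I)^{-1}(\bm M^{-1}\bm v+\bm y)\Big).$$ Algorithm. Initial parameters: $c$, a step size $\beta$, $\widehat{\bm\mu}_0\in\mathbb{R}^K$, $\widehat{\bm\Sigma}_0$ positive definite, $\widehat{\bm A}_0\in\mathbb{R}^{K\times K}$, $\widehat{\bm R}_{\omega,0}$ positive definite; $t=0$, $\widehat L_0=1$, $\widehat S_0=0$. For a matrix with eigendecomposition $\bm X=\sum_i\lambda_iv_iv_i^\top$, $\mathrm{Proj}(\bm X)=\sum_i\max\{\lambda_i,\epsilon\}v_iv_i^\top$, with a fixed $\epsilon>0$. While $\widehat S_t<c$, take a new observation $\bm y_{t+1}$ and do the following, with $\bm P_t=\widehat{\bm A}_t\widehat{\bm\Sigma}_t\widehat{\bm A}_t^\top+\widehat{\bm R}_{\omega,t}$: (i) $\widehat{\bm\Sigma}_{t+1}=\bm P_t(\bm P_t+\bm I)^{-1}$ and $\widehat{\bm\mu}_{t+1}=(\bm P_t+\bm I)^{-1}\widehat{\bm A}_t\widehat{\bm\mu}_t+\bm P_t(\bm P_t+\bm I)^{-1}\bm y_{t+1}$; (ii) $\log\widehat L_{t+1}=\log\widehat L_t+\widehat h_{t+1}(\widehat{\bm\mu}_{t+1},\bm y_{t+1})-\log p_\infty(\bm y_{t+1})$, where $\widehat h_{t+1}(\widehat{\bm\mu}_{t+1},\bm y_{t+1})=H(\widehat{\bm A}_t,\widehat{\bm R}_{\omega,t},\widehat{\bm\Sigma}_{t+1};\widehat{\bm\mu}_{t+1},\bm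 y_{t+1})$; and $\widehat S_{t+1}=\widehat S_t+\log\widehat L_{t+1}-\log\widehat L_t$; (iii) if $\widehat S_{t+1}<0$, set $\widehat{\bm A}_{t+1}=\widehat{\bm A}_0$, $\widehat{\bm R}_{\omega,t+1}=\widehat{\bm R}_{\omega,0}$, $\widehat S_{t+1}=0$, $\widehat L_{t+1}=1$; otherwise set $\widehat{\bm A}_{t+1}=\widehat{\bm A}_t+\beta\nabla_{\bm A}\widehat h_{t+1}(\widehat{\bm\mu}_{t+1},\bm y_{t+1})$ and $\widehat{\bm R}_{\omega,t+1}=\mathrm{Proj}\big(\widehat{\bm R}_{\omega,t}+\beta\nabla_{\bm R_\omega}\widehat h_{t+1}(\widehat{\bm\mu}_{t+1},\bm y_{t+1})\big)$, the gradients of $\widehat h_{t+1}(\widehat{\bm\mu}_{t+1},\bm y_{t+1})$ with respect to the matrix parameters $\bm A$ and $\bm R_\omega$ being evaluated at the current estimates; then increase $t$ by $1$. The stopping time is $\tau_{\mathrm{OGA}}=\inf\{t:\widehat S_t\ge c\}$.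
   Formalization: The stopping time is taken over t ≥ 1 (first observation); allowing t = 0, where the statistic is 0, would give stopping time 0 and make the claim false for γ ≤ 1; for γ > 1 nothing changes. *)

(* Defs.v *)
From HB Require Import structures.
From mathcomp Require Import all_boot all_order all_algebra.
From mathcomp Require Import all_classical all_reals all_analysis.

Set Implicit Arguments.
Unset Strict Implicit.
Unset Printing Implicit Defensive.

Import Order.TTheory GRing.Theory Num.Theory.
Import numFieldNormedType.Exports.

Local Open Scope classical_set_scope.
Local Open Scope ring_scope.

(* R^K is 'cV[R]_K; a 1 x 1 matrix product is read as a scalar through its
   entry at (ord0, ord0). *)

Definition posdef (R : realType) (K : nat) (X : 'M[R]_K) : Prop :=
  X^T = X /\
  forall u : 'cV[R]_K, u != 0 -> 0 < (u^T *m X *m u) ord0 ord0.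

(* The density p_oo of N(0, I) on R^K is the product of the K univariate
   standard normal densities. *)
Definition std_normal_pdf (R : realType) (K : nat) (y : 'cV[R]_K) : R :=
  \prod_(i < K) normal_pdf 0 1 (y i ord0).

Definition H (R : realType) (K : nat)
    (A Rw Sigma : 'M[R]_K) (mu y : 'cV[R]_K) : R :=
  let M := A *m Sigma *m A^T + Rw in
  let v := (M + 1%:M) *m (mu - Sigma *m y) in
  let N := invmx M + 1%:M in
  let w := invmx M *m v + y in
  ln ((Num.sqrt ((2 * pi) ^+ K * \det M))^-1 * (Num.sqrt (\det N))^-1)
  - 2^-1 * ((v^T *m invmx M *m v) ord0 ord0 + (y^T *m y) ord0 ord0
            - (w^T *m invmx N *m w) ord0 ord0).

Definition grad (R : realType) (K : nat) (f : 'M[R]_K -> R) (A : 'M[R]_K) :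
    'M[R]_K :=
  \matrix_(i, j) 'D_(delta_mx i j) f A.

(* Gradient of a function of a symmetric matrix, for the Frobenius inner
   product on symmetric matrices: the symmetric G such that
   \tr (G *m E) = 'D_E f X for every symmetric E. It depends only on the
   values of f at symmetric matrices; the matrix of entrywise derivatives need
   not be symmetric. *)
Definition sym_grad (R : realType) (K : nat) (f : 'M[R]_K -> R)
    (X : 'M[R]_K) : 'M[R]_K :=
  \matrix_(i, j) 'D_(2^-1 *: (delta_mx i j + delta_mx j i)) f X.

Definition is_eig_clip (R : realType) (K : nat) (eps : R) (X Y : 'M[R]_K) :
    Prop :=
  exists (lam : 'I_K -> R) (v : 'I_K -> 'cV[R]_K),
    [/\ forall i j, ((v i)^T *m v j) ord0 ord0 = (i == j)%:R,
        X = \sum_(i < K) lam i *: (v i *m (v i)^T)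
      & Y = \sum_(i < K) Num.max (lam i) eps *: (v i *m (v i)^T)].

(* By the spectral theorem, is_eig_clip eps X Y has exactly one solution Y when
   X is symmetric; the default value 0 is taken only for non-symmetric X. *)
Definition Proj (R : realType) (K : nat) (eps : R) (X : 'M[R]_K) : 'M[R]_K :=
  xget 0 [set Y | is_eig_clip eps X Y].

Record oga_state (R : realType) (K : nat) := OgaState {
  st_mu : 'cV[R]_K;
  st_Sigma : 'M[R]_K;
  st_A : 'M[R]_K;
  st_R : 'M[R]_K;
  st_L : R;
  st_S : R }.

(* In both gradients the filtered quantities Sigma' and mu' are held fixed:
   only the explicit matrix argument of H varies. *)
Definition oga_step (R : realType) (K : nat) (beta eps : R) (A0 R0 : 'M[R]_K)
    (s : oga_state R K) (y : 'cV[R]_K) : oga_state R K :=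
  let P := st_A s *m st_Sigma s *m (st_A s)^T + st_R s in
  let Sigma' := P *m invmx (P + 1%:M) in
  let mu' := invmx (P + 1%:M) *m st_A s *m st_mu s
             + P *m invmx (P + 1%:M) *m y in
  let L' := expR (ln (st_L s) + H (st_A s) (st_R s) Sigma' mu' y
                  - ln (std_normal_pdf y)) in
  let S' := st_S s + ln L' - ln (st_L s) in
  if S' < 0 then OgaState mu' Sigma' A0 R0 1 0
  else OgaState mu' Sigma'
    (st_A s + beta *: grad (fun A => H A (st_R s) Sigma' mu' y) (st_A s))
    (Proj eps
       (st_R s + beta *: sym_grad (fun Rw => H (st_A s) Rw Sigma' mu' y)
                                  (st_R s)))
    L' S'.

(* The entry y t of the data stream is the observation y_{t+1}. The recursion
   is continued past the stopping time, which does not affect the latter. *)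
Fixpoint oga_run (R : realType) (K : nat) (beta eps : R)
    (mu0 : 'cV[R]_K) (Sigma0 A0 R0 : 'M[R]_K) (y : nat -> 'cV[R]_K)
    (t : nat) : oga_state R K :=
  if t is t'.+1 then
    oga_step beta eps A0 R0
      (oga_run beta eps mu0 Sigma0 A0 R0 y t') (y t')
  else OgaState mu0 Sigma0 A0 R0 1 0.

(* The value is +oo if the threshold is never reached. Times start at t = 1,
   the time of the first observation; since S_0 = 0, admitting t = 0 would
   change the value only for c <= 0. *)
Definition tau_OGA (R : realType) (K : nat) (c beta eps : R)
    (mu0 : 'cV[R]_K) (Sigma0 A0 R0 : 'M[R]_K) (y : nat -> 'cV[R]_K) :
    \bar R :=
  ereal_inf [set (t%:R)%:E | t in
    [set t : nat | (0 < t)%N /\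
                   c <= st_S (oga_run beta eps mu0 Sigma0 A0 R0 y t)]].

Definition Borel (R : realType) (K : nat) : set (set 'cV[R]_K) :=
  <<s [set B : set 'cV[R]_K | open B] >>.

Definition random_vector (d : measure_display) (T : measurableType d)
    (R : realType) (K : nat) (X : T -> 'cV[R]_K) : Prop :=
  forall B : set 'cV[R]_K, Borel B -> measurable (X @^-1` B).

(* N(0, I) is the K-fold product of N(0, 1), determined by its values on boxes. *)
Definition has_law_std_normal (d : measure_display) (T : measurableType d)
    (R : realType) (P : probability T R) (K : nat) (X : T -> 'cV[R]_K) :
    Prop :=
  forall C : 'I_K -> set R, (forall i, measurable (C i)) ->
    P [set w | forall i, C i (X w i ord0)] =
    (\prod_(i < K) normal_prob 0 1 (C i))%E.

Definition mutually_independent (d : measure_display) (T : measurableType d)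
    (R : realType) (P : probability T R) (K : nat)
    (X : nat -> T -> 'cV[R]_K) : Prop :=
  forall (s : seq nat) (B : nat -> set 'cV[R]_K),
    uniq s -> (forall t, t \in s -> Borel (B t)) ->
    P (\bigcap_(t in [set` s]) (X t @^-1` B t)) =
    (\prod_(t <- s) P (X t @^-1` B t))%E.

Definition iid_std_normal (d : measure_display) (T : measurableType d)
    (R : realType) (P : probability T R) (K : nat)
    (y : nat -> T -> 'cV[R]_K) : Prop :=
  [/\ forall t, random_vector (y t),
      forall t, has_law_std_normal P (y t)
    & mutually_independent P y].

(* Main.v *)
(* The log-ratio added at time t+1 is that of the N(v, M + I) density to the
   N(0, I) density, where v = (M + I)(mu_{t+1} - Sigma_{t+1} y_{t+1}) and M
   depend only on y_1, ..., y_t: by (i), y_{t+1} cancels in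
   mu_{t+1} - Sigma_{t+1} y_{t+1}. So the likelihood ratio l_{t+1} has
   conditional mean 1 given the past, and the Shiryaev-Roberts statistic D_0 = 0,
   D_{t+1} = (1 + D_t) l_{t+1} makes D_t - t a martingale. Since
   exp S_{t+1} = max(1, exp S_t * l_{t+1}), we have exp S_t <= max(1, D_t), hence
   D_tau >= gamma when gamma > 1, and optional stopping gives E tau >= gamma.
   For gamma <= 1 the bound is tau >= 1.

   The ratio is diagonalised through M = V^T diag(lam) V: it is a product of
   one-dimensional Gaussian ratios, each a mixture of exponentials
   exp(x s - x^2 / 2), and Tonelli reduces its mean to the Gaussian moment
   generating function. *)
Require Import Defs.
From HB Require Import structures.
From mathcomp Require Import all_boot all_order all_algebra complex.
From mathcomp Require Import all_classical all_reals all_analysis.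
From mathcomp Require Import measurable_realfun ring lra.

Set Implicit Arguments.
Unset Strict Implicit.
Unset Printing Implicit Defensive.

Import Order.TTheory GRing.Theory Num.Theory.
Import numFieldNormedType.Exports.

Local Open Scope classical_set_scope.
Local Open Scope ring_scope.

(** * Spectral theorem for real symmetric matrices *)

(** The mean of one step is computed with the past frozen, through Tonelli on an independent pair
    (past, new observation). So every component of the state must be a measurable function of the
    past, and two of them are not visibly so. The gradients are limits of difference quotients,
    which converge only where [H] is differentiable; this forces the invariant that both covariance
    estimates stay positive definite. [Proj] is picked by [xget] from eigendecompositions, and
    eigenvectors need not depend measurably on the matrix; it is recovered as a pointwise limit of
    rational matrix functions. Both points rest on a spectral calculus for real symmetric matrices.
    Neither integrability nor almost sure finiteness of the stopping time is known in advance.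
    Optional stopping is therefore run up to a fixed n, where it leaves an error proportional to
    P(tau > n); if E tau were finite, this error would be O(1/n). *)

Lemma symmetric_eigenvalue_exists (R : rcfType) (n : nat) (X : 'M[R]_n.+1) :
  X^T = X -> exists a, eigenvalue X a.
Proof.
move=> XT; pose Y := map_mx (real_complex R) X.
have Yherm : Y \is hermsymmx.
  apply: realsym_hermsym.
    by apply/is_hermitianmxP; rewrite expr0 scale1r map_mx_id// map_trmx XT.
  by apply/mxOverP => i j; rewrite mxE; apply/complex_realP; exists (X i j).
have /mxOverP/(_ 0 0)/complex_realP[a aE] := hermitian_spectral_diag_real Yherm.
(* Being an eigenvalue is a root condition on the characteristic polynomial, so it may be checked
   over the complex extension, where the first row of the spectral matrix is an eigenvector. *)
exists a; rewrite eigenvalue_root_char -(fmorph_root (real_complex R)).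
rewrite map_char_poly -eigenvalue_root_char; apply/eigenvalueP.
have Punit := spectral_unit Y.
have /hermitian_normalmx/orthomx_spectralP := Yherm.
move: aE Punit; set P := spectralmx Y; set D := spectral_diag Y => aE Punit YE.
exists (row 0 P).
  rewrite -/Y YE !mulmxA rowE mulmxK//.
  by rewrite -(rowE 0 (diag_mx D)) row_diag_mx aE -scalemxAl.
apply: contraTneq Punit => P0.
rewrite unitmxE unitfE (expand_det_row _ 0) big1 ?eqxx// => j _.
by have /rowP/(_ j) := P0; rewrite !mxE => ->; rewrite mul0r.
Qed.

Lemma sum_sqr_gt0 (R : realDomainType) (n : nat) (u : 'rV[R]_n) :
  u != 0 -> 0 < (u *m u^T) 0 0.
Proof.
move=> u0; rewrite mxE; under eq_bigr do rewrite mxE -expr2.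
have [j uj] : exists j, u 0 j != 0.
  by apply/existsP; apply: contraR u0; rewrite negb_exists => /forallP u0;
    apply/eqP/rowP => j; rewrite mxE; apply/eqP; have := u0 j; rewrite negbK.
rewrite (bigD1 j)//= ltr_pwDl// ?exprn_even_gt0//.
by apply: sumr_ge0 => i _; exact: sqr_ge0.
Qed.

(** Reflection in the hyperplane orthogonal to [u - e] exchanges the unit vectors [u] and [e]. It is
    its own inverse and transpose, so conjugation by it is just [Q *m X *m Q]. *)
Lemma householder (R : rcfType) (n : nat) (u : 'rV[R]_n.+1) :
  (u *m u^T) 0 0 = 1 ->
  exists Q : 'M[R]_n.+1, [/\ Q^T = Q, Q *m Q = 1%:M & u *m Q = delta_mx 0 0].
Proof.
move=> u1; pose e : 'rV[R]_n.+1 := delta_mx 0 0.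
have [->|ue] := eqVneq u e.
  by exists 1%:M; split; rewrite ?trmx1 ?mulmx1.
have [w wE] : exists w : 'rV[R]_n.+1, w = u - e by exists (u - e).
have w0 : w != 0 by rewrite wE subr_eq0.
have := sum_sqr_gt0 w0; set c := (w *m w^T) 0 0 => c0.
have wwT : w *m w^T = c%:M by rewrite [LHS]mx11_scalar.
have ee : e *m e^T = 1%:M.
  by rewrite /e trmx_delta mul_delta_mx; apply/matrixP => i j; rewrite !mxE !ord1.
exists (1%:M - (2 / c) *: (w^T *m w)); split.
- by rewrite linearB linearZ/= trmx_mul trmxK trmx1.
- set S := w^T *m w; set k := 2 / c.
  have SS : S *m S = c *: S.
    by rewrite /S mulmxA -(mulmxA _ w) wwT mul_mx_scalar scalemxAl.
  have -> : (1%:M - k *: S) *m (1%:M - k *: S) = 1%:M + (k * k * c - k - k) *: S.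
    rewrite mulmxBl mul1mx mulmxBr mulmx1 -scalemxAl -scalemxAr SS !scalerA.
    by rewrite !scalerBl opprB -!addrA; congr (_ + _); rewrite addrCA.
  rewrite [X in X *: _](_ : _ = 0) ?scale0r ?addr0//.
  by rewrite /k; field; rewrite gt_eqF.
- have tr11 (Z : 'M[R]_1) : Z^T = Z by apply/matrixP => i j; rewrite mxE !ord1.
  have uT : u *m u^T = 1%:M by rewrite [LHS]mx11_scalar u1.
  have eu : e *m u^T = u *m e^T.
    by rewrite -[LHS]tr11 trmx_mul trmxK.
  (* Unit lengths give |w|^2 = 2 - 2 <u, e>, hence <u, w> = c / 2, which is exactly what makes the
     reflection send u to u - w = e. *)
  have cE : c = 2 - 2 * (u *m e^T) 0 0.
    rewrite /c wE linearB/= mulmxBl !mulmxBr uT ee eu !mxE/=; ring.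
  have uw : u *m w^T = (c / 2)%:M.
    rewrite [LHS]mx11_scalar cE wE linearB/= mulmxBr uT; congr (_%:M).
    by rewrite !mxE/=; field.
  rewrite mulmxBr mulmx1 -scalemxAr mulmxA uw mul_scalar_mx scalerA.
  rewrite [X in X *: _](_ : _ = 1).
    by rewrite scale1r wE opprB addrC subrK.
  by field; rewrite gt_eqF.
Qed.

(** Deflation: once a unit eigenvector is moved to the first basis vector, symmetry makes the matrix
    block diagonal and induction handles the lower block. The eigenvectors are the rows of [V]. *)
Theorem real_spectral (R : rcfType) (n : nat) (X : 'M[R]_n) : X^T = X ->
  exists (V : 'M[R]_n) (d : 'rV[R]_n),
    V *m V^T = 1%:M /\ X = V^T *m diag_mx d *m V.
Proof.
elim: n X => [|n IH] X XT.
  by exists 1%:M, 0; split; apply/matrixP => -[].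
have [a /eigenvalueP[v vX v0]] := symmetric_eigenvalue_exists XT.
have v2 := sum_sqr_gt0 v0.
pose u := (Num.sqrt ((v *m v^T) 0 0))^-1 *: v.
have u1 : (u *m u^T) 0 0 = 1.
  rewrite /u linearZ/= -scalemxAl -scalemxAr scalerA mxE -invfM -expr2.
  by rewrite sqr_sqrtr ?ltW// mulVf// gt_eqF.
have uX : u *m X = a *: u by rewrite -scalemxAl vX !scalerA mulrC.
have [Q [QT QQ uQ]] := householder u1.
have eQ : delta_mx 0 0 *m Q = u by rewrite -uQ -mulmxA QQ mulmx1.
pose Y : 'M[R]_(1 + n) := Q *m X *m Q.
have YT : Y^T = Y by rewrite /Y !trmx_mul QT XT mulmxA.
have Y0 : row 0 Y = a *: delta_mx 0 0.
  by rewrite rowE /Y !mulmxA eQ uX -scalemxAl uQ.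
have Yur : ursubmx Y = 0.
  apply/matrixP => i j; rewrite !mxE !ord1.
  have /rowP/(_ (rshift 1 j)) := Y0; rewrite !mxE/=.
  by rewrite [lshift _ _](_ : _ = 0) => [->|]; [rewrite mulr0|exact/val_inj].
have Yul : ulsubmx Y = a%:M.
  apply/matrixP => i j; rewrite !mxE !ord1/=.
  have /rowP/(_ 0) := Y0; rewrite !mxE/= mulr1 mulr1n.
  by rewrite [lshift _ _](_ : _ = 0) => [->|]; [|exact/val_inj].
have Ydl : dlsubmx Y = 0 by rewrite -[Y]YT -trmx_ursub Yur trmx0.
have [|W [d [WW Yd]]] := IH (drsubmx Y); first by rewrite trmx_drsub YT.
pose V1 : 'M[R]_(1 + n) := block_mx 1%:M 0 0 W.
have V1V1 : V1 *m V1^T = 1%:M.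
  rewrite tr_block_mx mulmx_block !trmx0 !trmx1 !mulmx0 !mul0mx !addr0 !add0r.
  by rewrite mulmx1 WW -scalar_mx_block.
have YV1 : Y = V1^T *m diag_mx (row_mx a%:M d) *m V1.
  rewrite -[LHS]submxK Yul Yur Ydl Yd tr_block_mx diag_mx_row !mulmx_block.
  rewrite !trmx0 !trmx1 !(mulmx0, mul0mx, addr0, add0r, mul1mx, mulmx1).
  by congr block_mx; apply/matrixP => i j; rewrite !mxE !ord1/= mulr1n.
exists (V1 *m Q), (row_mx a%:M d); split.
  by rewrite trmx_mul QT mulmxA -(mulmxA V1) QQ mulmx1.
have -> : X = Q *m Y *m Q.
  by rewrite /Y !mulmxA QQ mul1mx -mulmxA QQ mulmx1.
by rewrite trmx_mul QT YV1 !mulmxA.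
Qed.

(** For orthogonal [V], the matrix with eigenvalues [d i] on the rows of [V]. With [V] fixed, sums,
    products and inverses of matrices become pointwise operations on [d]. *)
Definition spmx (R : realType) (K : nat) (V : 'M[R]_K) (d : 'I_K -> R) : 'M[R]_K :=
  V^T *m diag_mx (\row_i d i) *m V.

Section spectral_calculus.
Context (R : realType) (K : nat) (V : 'M[R]_K).
Hypothesis VV : V *m V^T = 1%:M.
Implicit Types d e : 'I_K -> R.

Lemma spmxM d e : spmx V d *m spmx V e = spmx V (fun i => d i * e i).
Proof.
rewrite /spmx !mulmxA -(mulmxA _ V) VV mulmx1 -(mulmxA V^T) mulmx_diag.
by congr (_ *m diag_mx _ *m _); apply/rowP => j; rewrite !mxE.
Qed.

Lemma spmxD d e : spmx V d + spmx V e = spmx V (fun i => d i + e i).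
Proof.
rewrite /spmx -mulmxDl -mulmxDr -linearD.
by congr (_ *m diag_mx _ *m _); apply/rowP => j; rewrite !mxE.
Qed.

Lemma spmxZ a d : a *: spmx V d = spmx V (fun i => a * d i).
Proof.
rewrite /spmx scalemxAl scalemxAr -linearZ.
by congr (_ *m diag_mx _ *m _); apply/rowP => j; rewrite !mxE.
Qed.

Lemma spmx_cst a : a%:M = spmx V (fun=> a).
Proof.
rewrite /spmx (_ : \row__ a = const_mx a) ?diag_const_mx; last first.
  by apply/rowP => j; rewrite !mxE.
by rewrite mul_mx_scalar -scalemxAl (mulmx1C VV) scalemx1.
Qed.

Lemma eq_spmx d e : d =1 e -> spmx V d = spmx V e.
Proof. by move=> /funext->. Qed.

Lemma spmxT d : (spmx V d)^T = spmx V d.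
Proof. by rewrite /spmx !trmx_mul tr_diag_mx trmxK mulmxA. Qed.

Lemma det_spmx d : \det (spmx V d) = \prod_i d i.
Proof.
rewrite /spmx !det_mulmx mulrC mulrA -det_mulmx VV det1 mul1r det_diag.
by apply: eq_bigr => i _; rewrite mxE.
Qed.

Lemma spmx_unit d : (forall i, d i != 0) -> spmx V d \in unitmx.
Proof.
move=> d0; rewrite unitmxE det_spmx unitfE.
by apply/prodf_neq0 => i _.
Qed.

Lemma invmx_spmx d : (forall i, d i != 0) ->
  invmx (spmx V d) = spmx V (fun i => (d i)^-1).
Proof.
move=> d0; rewrite -[LHS]mulmx1 (spmx_cst 1).
rewrite (eq_spmx (d := fun=> 1) (e := fun i => d i * (d i)^-1)) => [|i]; last by rewrite divff.
by rewrite -spmxM mulKmx// spmx_unit.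
Qed.

Lemma quad_spmx d (u : 'cV[R]_K) :
  (u^T *m spmx V d *m u) 0 0 = \sum_i d i * ((V *m u) i 0) ^+ 2.
Proof.
rewrite /spmx !mulmxA -mulmxA -trmx_mul mxE; apply: eq_bigr => i _.
by rewrite mul_mx_diag !mxE mulrAC mulrC expr2.
Qed.

Lemma trace_spmx d : \tr (spmx V d) = \sum_i d i.
Proof.
rewrite /spmx mxtrace_mulC mulmxA VV mul1mx mxtrace_diag.
by apply: eq_bigr => i _; rewrite mxE.
Qed.

Lemma spmx_sum d : spmx V d = \sum_i d i *: ((row i V)^T *m row i V).
Proof.
apply/matrixP => a b; rewrite /spmx mul_mx_diag summxE mxE.
by apply: eq_bigr => i _; rewrite !mxE big_ord1 !mxE mulrCA mulrA.
Qed.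

Lemma posdef_spmx d : (forall i, 0 < d i) -> posdef (spmx V d).
Proof.
move=> d0; split=> [|u u0]; first exact: spmxT.
rewrite quad_spmx.
have Vu0 : V *m u != 0.
  apply: contra u0 => /eqP Vu; rewrite -[u]mul1mx -(mulmx1C VV) -mulmxA Vu.
  by rewrite mulmx0.
have [i Vui] : exists i, (V *m u) i 0 != 0.
  apply/existsP; apply: contraR Vu0; rewrite negb_exists => /forallP Vu0.
  by apply/eqP/colP => j; rewrite [RHS]mxE; apply/eqP; rewrite -[_ == _]negbK.
rewrite (bigD1 i)//= ltr_pwDl//.
  by rewrite pmulr_rgt0// exprn_even_gt0.
by apply: sumr_ge0 => j _; rewrite mulr_ge0 ?sqr_ge0// ltW.
Qed.

Lemma posdef_spmx_gt0 d : posdef (spmx V d) -> forall i, 0 < d i.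
Proof.
move=> [_ dP] i; have := dP (V^T *m delta_mx i 0).
rewrite quad_spmx mulmxA VV mul1mx (bigD1 i)//= big1 => [|j ji]; last first.
  by rewrite mxE (negbTE ji) expr2 mulr0 mulr0.
rewrite !mxE !eqxx expr1n mulr1 addr0; apply.
apply/eqP => /(congr1 (mulmx V)); rewrite mulmxA VV mul1mx mulmx0.
by move=> /colP/(_ i); rewrite !mxE !eqxx => /eqP; rewrite oner_eq0.
Qed.

End spectral_calculus.

(** * Positive definite matrices and eigenvalue clipping *)

Section positive_definite.
Context (R : realType) (K : nat).
Implicit Types (A X P : 'M[R]_K).

Lemma symmetric_spmx X : X^T = X ->
  exists (V : 'M[R]_K) d, V *m V^T = 1%:M /\ X = spmx V d.
Proof.
move=> /real_spectral[V [d [VV ->]]]; exists V, (fun i => d 0 i); split=> //.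
by congr (_ *m diag_mx _ *m _); apply/rowP => j; rewrite !mxE.
Qed.

Lemma posdef_spectral X : posdef X ->
  exists (V : 'M[R]_K) d, [/\ V *m V^T = 1%:M, X = spmx V d & forall i, 0 < d i].
Proof.
move=> Xpos; have [V [d [VV XE]]] := symmetric_spmx Xpos.1.
by exists V, d; split=> //; apply: (posdef_spmx_gt0 VV); rewrite -XE.
Qed.

Lemma posdef_det_gt0 X : posdef X -> 0 < \det X.
Proof.
by move=> /posdef_spectral[V [d [VV -> d0]]]; rewrite det_spmx// prodr_gt0.
Qed.

Lemma posdef_add1 X : posdef X -> posdef (X + 1%:M).
Proof.
move=> /posdef_spectral[V [d [VV -> d0]]].
by rewrite (spmx_cst VV) spmxD; apply: posdef_spmx => // i; rewrite addr_gt0.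
Qed.

Lemma posdef_inv X : posdef X -> posdef (invmx X).
Proof.
move=> /posdef_spectral[V [d [VV -> d0]]].
rewrite invmx_spmx//; first by apply: posdef_spmx => // i; rewrite invr_gt0.
by move=> i; rewrite gt_eqF.
Qed.

Lemma posdef_filter P : posdef P -> posdef (P *m invmx (P + 1%:M)).
Proof.
move=> /posdef_spectral[V [d [VV -> d0]]].
have d1 i : 0 < d i + 1 by rewrite addr_gt0.
rewrite (spmx_cst VV) spmxD invmx_spmx//; last by move=> i; rewrite gt_eqF.
by rewrite spmxM//; apply: posdef_spmx => // i; rewrite divr_gt0.
Qed.

Lemma posdef_predict A S X : posdef S -> posdef X -> posdef (A *m S *m A^T + X).
Proof.
move=> [ST Spos] [XT Xpos]; split.
  by rewrite linearD/= !trmx_mul trmxK ST XT mulmxA.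
(* [A] may be singular, so the first summand is only nonnegative; strictness comes from [X]. *)
move=> u u0; rewrite mulmxDr mulmxDl mxE ltr_wpDl ?Xpos//.
rewrite !mulmxA -mulmxA -(mulmxA _ S) -[u^T *m A]trmxK trmx_mul trmxK mulmxA.
have [->|Au0] := eqVneq (A^T *m u) 0; first by rewrite mulmx0 mxE.
exact/ltW/Spos.
Qed.

Lemma is_eig_clipP eps X Y : is_eig_clip eps X Y <->
  exists (V : 'M[R]_K) d, [/\ V *m V^T = 1%:M, X = spmx V d &
    Y = spmx V (fun i => Num.max (d i) eps)].
Proof.
split=> [[d [v [vv -> ->]]]|[V [d [VV -> ->]]]].
  pose V : 'M[R]_K := \matrix_(i, j) v i j 0.
  have rV i : row i V = (v i)^T by apply/rowP => j; rewrite !mxE.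
  exists V, d; split; rewrite ?spmx_sum; try by apply: eq_bigr => i _; rewrite rV trmxK.
  apply/matrixP => i j; have := vv i j; rewrite !mxE => <-.
  by apply: eq_bigr => k _; rewrite !mxE.
exists d, (fun i => (row i V)^T); split; rewrite ?spmx_sum; last 2 first.
- by apply: eq_bigr => i _; rewrite trmxK.
- by apply: eq_bigr => i _; rewrite trmxK.
move=> i j; have /matrixP/(_ i j) := VV; rewrite !mxE => <-.
by apply: eq_bigr => k _; rewrite !mxE.
Qed.

Lemma Proj_clip eps X : X^T = X -> is_eig_clip eps X (Proj eps X).
Proof.
move=> /symmetric_spmx[V [d [VV XE]]]; apply: xgetPex.
by exists (spmx V (fun i => Num.max (d i) eps)); apply/is_eig_clipP; exists V, d.
Qed.

Lemma Proj_posdef eps X : 0 < eps -> X^T = X -> posdef (Proj eps X).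
Proof.
move=> eps0 /(Proj_clip eps)/is_eig_clipP[V [d [VV _ ->]]].
by apply: posdef_spmx => // i; rewrite lt_max eps0 orbT.
Qed.

End positive_definite.

(** The base [1 - z / s] lies in (0, 1) for z > 0 and exceeds 1 for z < 0, so its powers tend to 0
    or to infinity and the quotient tends to z or to 0. *)
Lemma cvg_pospart (R : realType) (z s : R) : `|z| < s ->
  (z / (1 + (1 - z / s) ^+ n)) @[n --> \oo] --> Num.max z 0.
Proof.
move=> zs; have s0 : 0 < s by exact: le_lt_trans zs.
have zs1 : `|z / s| < 1 by rewrite normrM normfV (gtr0_norm s0) ltr_pdivrMr// mul1r.
move: zs1; rewrite ltr_norml => /andP[zs1 zs2].
have [z0|z0] := leP z 0; last first.
- have r1 : `|1 - z / s| < 1.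
    rewrite ger0_norm ?subr_ge0 ?ltW// ltrBlDr ltrDl.
    by rewrite divr_gt0.
  rewrite -[X in _ --> X](_ : z / (1 + 0) = z); last by rewrite addr0 divr1.
  apply: cvgMr; apply: cvgV; first by rewrite addr0 oner_eq0.
  by apply: cvgD; [exact: cvg_cst|exact: cvg_expr].
- have [->|zn0] := eqVneq z 0; first by under eq_fun do rewrite mul0r; exact: cvg_cst.
  have {zn0}z0 : z < 0 by rewrite lt_neqAle zn0.
  have r1 : `|(1 - z / s)^-1| < 1.
    have : 1 < 1 - z / s by rewrite ltrDl oppr_gt0 pmulr_llt0// invr_gt0.
    move=> r1; have r0 := lt_trans ltr01 r1.
    by rewrite ger0_norm ?invr_ge0 ?(ltW r0)// invf_lt1.
  have r0 : 0 < 1 - z / s by rewrite subr_gt0.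
  rewrite -[X in _ --> X](_ : z * (0 / (0 + 1)) = 0); last by rewrite mul0r mulr0.
  under eq_fun => n.
    rewrite (_ : z / _ = z * ((1 - z / s)^-1 ^+ n / ((1 - z / s)^-1 ^+ n + 1))).
    over.
    have e0 : (1 - z / s) ^+ n != 0 by rewrite gt_eqF// exprn_gt0.
    have e1 : (1 - z / s) ^+ n + 1 != 0 by rewrite gt_eqF// addr_gt0// exprn_gt0.
    rewrite exprVn; move: e0 e1; set w := _ ^+ n => e0 e1; congr (z * _).
    by field; rewrite e0 addrC.
  apply: cvgMr; apply: cvgM; first exact: cvg_expr.
  apply: cvgV; first by rewrite add0r oner_eq0.
  by apply: cvgD; [exact: cvg_expr|exact: cvg_cst].
Qed.

(* A rational function of X, hence measurable in X; on an eigenvalue z of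
   X - eps it is z / (1 + (1 - z / s) ^+ n) with s > `|z|, which tends to
   max(z, 0). *)
Definition clip_approx (R : realType) (K : nat) (eps : R) (X : 'M[R]_K) (n : nat) :
    'M[R]_K :=
  let Z := X - eps%:M in
  let r := 1%:M - (1 + \tr (Z *m Z))^-1 *: Z in
  Z *m invmx (1%:M + iter n (mulmx r) 1%:M) + eps%:M.

Lemma cvg_clip_approx (R : realType) (K : nat) (eps : R) (X Y : 'M[R]_K) i j :
  is_eig_clip eps X Y -> clip_approx eps X n i j @[n --> \oo] --> Y i j.
Proof.
move=> /is_eig_clipP[V [d [VV -> ->]]].
have -> : spmx V (fun i => Num.max (d i) eps) =
    spmx V (fun i => Num.max (d i - eps) 0) + eps%:M.
  rewrite (spmx_cst VV) spmxD; apply: eq_spmx => k.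
  by rewrite addr_maxl subrK add0r.
have ZE : spmx V d - eps%:M = spmx V (fun i => d i - eps).
  by rewrite (spmx_cst VV) -scaleN1r spmxZ spmxD; apply: eq_spmx => k; rewrite mulN1r.
(* This is 1 plus the trace of the square of [X - eps%:M]. It dominates every eigenvalue because |z|
   < 1 + z^2, and it is polynomial in the entries of the matrix. *)
pose s := 1 + \sum_i (d i - eps) ^+ 2.
have zs k : `|d k - eps| < s.
  rewrite /s; set z := d k - eps.
  apply: (@lt_le_trans _ _ (1 + z ^+ 2)).
    by rewrite -real_normK ?num_real//; nra.
  rewrite lerD2l (bigD1 k)//= lerDl; apply: sumr_ge0 => l _; exact: sqr_ge0.
have s0 : 0 < s by rewrite ltr_wpDr// sumr_ge0// => k _; exact: sqr_ge0.
have rE n : iter n (mulmx (1%:M - s^-1 *: spmx V (fun i => d i - eps))) 1%:M =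
    spmx V (fun i => (1 - (d i - eps) / s) ^+ n).
  elim: n => [|n IH].
    by rewrite (spmx_cst VV); apply: eq_spmx => k; rewrite expr0.
  rewrite iterS IH (spmx_cst VV 1) -scaleN1r !spmxZ spmxD spmxM//.
  by apply: eq_spmx => k; rewrite exprS mulN1r mulrC (mulrC s^-1) mulrC.
have r0 n k : 0 <= (1 - (d k - eps) / s) ^+ n.
  rewrite exprn_ge0// subr_ge0 ler_pdivrMr// mul1r ltW//.
  by rewrite (le_lt_trans _ (zs k))// ler_norm.
have cE n : clip_approx eps (spmx V d) n =
    spmx V (fun i => (d i - eps) / (1 + (1 - (d i - eps) / s) ^+ n)) + eps%:M.
  rewrite /clip_approx ZE; congr (_ + _).
  rewrite spmxM// trace_spmx// -/s rE (spmx_cst VV 1) spmxD invmx_spmx// ?spmxM//.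
  by move=> k; rewrite gt_eqF// ltr_wpDr.
under eq_fun do rewrite cE mxE; rewrite mxE.
apply: cvgD; last exact: cvg_cst.
under eq_fun do rewrite spmx_sum summxE; rewrite spmx_sum summxE.
apply: cvg_big => [|k _]; first exact: add_continuous.
under eq_fun do rewrite mxE; rewrite mxE.
by apply: cvgMl; exact: cvg_pospart.
Qed.

(** * Integration against independent sigma-algebras *)

Section independence.
Context (R : realType) (d : measure_display) (T : measurableType d)
  (P : probability T R).
Local Open Scope ereal_scope.

(** In [A], both sides are finite measures, namely [P] restricted to [B] and [P] scaled by [P B].
    They agree on a pi-system containing the whole space, hence on what it generates. *)
Lemma indep_g_sigma (G : set (set T)) (B : set T) :
  setI_closed G -> G setT -> G `<=` measurable -> measurable B ->
  (forall A, G A -> P (A `&` B) = P A * P B) ->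
  forall A, <<s G >> A -> P (A `&` B) = P A * P B.
Proof.
move=> IG GT Gm mB GB A sA.
have PBge0 : (0 <= fine (P B))%R by exact: fine_ge0.
have mscaleE C : mscale (NngNum PBge0) P C = P B * P C.
  by rewrite /mscale/= fineK// fin_num_measure.
transitivity (mscale (NngNum PBge0) P A); last by rewrite mscaleE muleC.
apply: (@g_sigma_algebra_measure_unique _ R T G Gm (fun=> setT) (fun=> GT) _
  (mrestr P mB)) => //.
- by rewrite bigcup_const//; exists 0%N.
- by move=> C GC; apply: etrans (esym (mscaleE C)); apply: etrans (GB _ GC) _; rewrite muleC.
- move=> _; suff : P (setT `&` B) < +oo by [].
  by rewrite setTI ltey_eq fin_num_measure.
Qed.

(** Independence makes the joint law the product of the marginals, and Tonelli applies. With [X1]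
    the identity into [T] under a smaller sigma-algebra, this takes the place of conditioning on
    that sigma-algebra. *)
Lemma integral_indep d1 d2 (T1 : measurableType d1) (T2 : measurableType d2)
    (X1 : T -> T1) (X2 : T -> T2) (f : T1 * T2 -> \bar R) :
  measurable_fun setT X1 -> measurable_fun setT X2 ->
  (forall A B, measurable A -> measurable B ->
    P (X1 @^-1` A `&` X2 @^-1` B) = P (X1 @^-1` A) * P (X2 @^-1` B)) ->
  measurable_fun setT f -> (forall x, 0 <= f x) ->
  \int[P]_w f (X1 w, X2 w) = \int[P]_w \int[P]_w' f (X1 w, X2 w').
Proof.
move=> mX1 mX2 X12 mf f0.
pose Y1 : {mfun T >-> T1} := mfun_Sub (mem_set mX1).
pose Y2 : {mfun T >-> T2} := mfun_Sub (mem_set mX2).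
have mX12 : measurable_fun setT (fun w => (X1 w, X2 w)).
  exact: measurable_fun_pair.
pose Y : {mfun T >-> (T1 * T2)%type} := mfun_Sub (mem_set mX12).
have PE X : measurable X ->
    (distribution P Y1 \x distribution P Y2) X = distribution P Y X.
  by apply: product_measure_unique => A B mA mB; exact: X12.
transitivity (\int[distribution P Y]_z f z).
  by rewrite ge0_integral_distribution.
transitivity (\int[distribution P Y1 \x distribution P Y2]_z f z).
  by apply: eq_measure_integral => X mX _; apply/esym/PE.
rewrite fubini_tonelli1// ge0_integral_distribution//; last 2 first.
- exact: measurable_fun_fubini_tonelli_F.
- by move=> x; exact: integral_ge0.
apply: eq_integral => w _; rewrite /= /fubini_F ge0_integral_distribution//.
exact: measurableT_comp.
Qed.

Lemma measurable_id_g_sigma (G : set (set T)) : G `<=` measurable ->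
  measurable_fun setT (id : T -> g_sigma_algebraType G).
Proof.
move=> Gm _ A sA; rewrite setTI.
exact: (smallest_sub (@sigma_algebra_measurable _ T) Gm).
Qed.

End independence.

(** * Gaussian integrals *)

(** [f x] is the length of [[0, f x[], and Tonelli exchanges x with the level t. *)
Lemma layer_cake (R : realType) (d : measure_display) (T : measurableType d)
    (mu : {sigma_finite_measure set T -> \bar R}) (p f : T -> R) :
  measurable_fun setT p -> (forall x, 0 <= p x) ->
  measurable_fun setT f -> (forall x, 0 <= f x) ->
  (\int[mu]_x (f x * p x)%:E =
   \int[lebesgue_measure]_t \int[mu]_(x in [set x | (0 <= t < f x)%R]) (p x)%:E)%E.
Proof.
move=> mp p0 mf f0.
pose S : set (T * R) := [set z | (0 <= z.2 < f z.1)].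
have mS : measurable S.
  have -> : S = snd @^-1` `[0, +oo[%classic `&`
                (fun z => f z.1 - z.2) @^-1` `]0, +oo[%classic.
    apply/seteqP; split=> z; rewrite /S /= !in_itv/= !andbT subr_gt0.
      by move=> /andP.
    by move=> ?; apply/andP.
  apply: measurableI; rewrite -[X in measurable X]setTI.
    exact: measurable_snd.
  suff: measurable_fun setT (fun z : T * R => f z.1 - z.2) by apply.
  by apply: measurable_funB => //; exact: measurableT_comp.
pose F (z : T * R) := (\1_S z)%:E : \bar R.
have mF : measurable_fun setT F by exact/measurable_EFinP/measurable_indic.
have F0 z : (0 <= F z)%E by rewrite lee_fin.
have fE x : (f x)%:E = (\int[lebesgue_measure]_t F (x, t))%E.
  transitivity (\int[lebesgue_measure]_(t in setT) (\1_(`[0, f x[%classic) t)%:E)%E.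
    rewrite integral_indic// setIT [RHS]lebesgue_measure_itv/= lte_fin.
    by have [_|] := ltP; rewrite ?sube0// => fx0; congr (_%:E); apply/le_anti; rewrite fx0 f0.
  apply: eq_integral => t _; rewrite /F !indicE.
  suff -> : (t \in `[0, f x[%classic) = ((x, t) \in S) by [].
  by apply/idP/idP => /set_mem ft; apply/mem_set; move: ft; rewrite /S/= in_itv.
have mFp : measurable_fun setT (fun z => F z * (p z.1)%:E)%E.
  by apply: emeasurable_funM => //; apply/measurable_EFinP; exact: measurableT_comp.
have Fp0 z : (0 <= F z * (p z.1)%:E)%E by rewrite mule_ge0// lee_fin.
transitivity (\int[mu]_x \int[lebesgue_measure]_t (F (x, t) * (p x)%:E))%E.
  apply: eq_integral => x _; rewrite ge0_integralZr//.
  - by rewrite -fE -EFinM.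
  - exact: measurableT_comp.
  - by rewrite lee_fin.
have := @fubini_tonelli _ _ _ _ _ mu lebesgue_measure _ mFp Fp0.
move=> /= ->; apply: eq_integral => t _.
rewrite [RHS]integral_mkcond; apply: eq_integral => x _.
rewrite patchE /F indicE.
have -> : (x \in [set x | 0 <= t < f x]) = ((x, t) \in S).
  by apply/idP/idP => /set_mem ?; exact/mem_set.
by case: ifP => _; rewrite ?mul1e ?mul0e.
Qed.

(** The layer-cake formula reduces both integrals to the masses of the level sets of [f], on which
    the law and the density agree by hypothesis. *)
Lemma integral_law_density (R : realType) (d : measure_display)
    (T : measurableType d) (P : probability T R) (X : T -> R) (p f : R -> R) :
  measurable_fun setT X -> measurable_fun setT p -> (forall x, 0 <= p x) ->
  (forall C, measurable C ->
    P (X @^-1` C) = (\int[lebesgue_measure]_(x in C) (p x)%:E)%E) ->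
  measurable_fun setT f -> (forall x, 0 <= f x) ->
  (\int[P]_w (f (X w))%:E = \int[lebesgue_measure]_x (f x * p x)%:E)%E.
Proof.
move=> mX mp p0 XE mf f0.
transitivity (\int[P]_w (f (X w) * cst 1 w)%:E)%E.
  by apply: eq_integral => w _; rewrite mulr1.
rewrite layer_cake//; last exact: measurableT_comp.
have := @layer_cake _ _ _ lebesgue_measure p f mp p0 mf f0.
move=> ->; apply: eq_integral => t _.
have mS : measurable [set x | 0 <= t < f x].
  have [t0|t0] := leP 0 t.
    have -> : [set x | true && (t < f x)] = f @^-1` `]t, +oo[%classic.
      by apply/seteqP; split=> x /=; rewrite in_itv/= andbT.
    by rewrite -[X in measurable X]setTI; exact: mf.
  by rewrite (_ : [set _ | _] = set0)// -subset0 => x.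
have mXS : measurable (X @^-1` [set x | 0 <= t < f x]).
  by rewrite -[X in measurable X]setTI; exact: mX.
by rewrite -XE//; apply: etrans (integral_cst _ mXS 1%E) _; rewrite mul1e.
Qed.

(** Completing the square: tilting N(0, 1) by [expR (w * x)] gives a multiple of the N(w, 1)
    density. *)
Lemma normal_mgf (R : realType) (w : R) :
  (\int[lebesgue_measure]_x (expR (w * x) * normal_pdf 0 1 x)%:E =
   (expR (w ^+ 2 / 2))%:E)%E.
Proof.
transitivity (\int[lebesgue_measure]_x
    ((expR (w ^+ 2 / 2))%:E * (normal_pdf w 1 x)%:E))%E.
  apply: eq_integral => x _; rewrite -EFinM; congr (_%:E).
  rewrite !normal_pdfE ?oner_eq0// mulrCA [RHS]mulrCA; congr (_ * _).
  by rewrite /normal_fun -!expRD; congr expR; field.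
rewrite ge0_integralZl ?integral_normal_pdf ?mule1 ?lee_fin ?expR_ge0//.
- by apply/measurable_EFinP; exact: measurable_normal_pdf.
- by move=> x _; rewrite lee_fin normal_pdf_ge0.
Qed.

(** The ratio at s of the N(m, 1 + sigma^2) density to the N(0, 1) density. *)
Definition gauss_ratio (R : realType) (m sigma s : R) : R :=
  (Num.sqrt (1 + sigma ^+ 2))^-1 *
  expR (s ^+ 2 / 2 - (s - m) ^+ 2 / (2 * (1 + sigma ^+ 2))).

(** [expR (x * s - x ^+ 2 / 2)] is the ratio at s of N(x, 1) to N(0, 1), and averaging x over N(m,
    sigma^2) turns N(x, 1) into N(m, 1 + sigma^2). *)
Lemma gauss_ratioE (R : realType) (m sigma s : R) : sigma != 0 ->
  (\int[lebesgue_measure]_x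
      (expR (x * s - x ^+ 2 / 2) * normal_pdf m sigma x)%:E =
   (gauss_ratio m sigma s)%:E)%E.
Proof.
move=> sigma0.
have q0 : 0 < 1 + sigma ^+ 2 by rewrite ltr_wpDr ?sqr_ge0.
have rq0 : 0 < Num.sqrt (1 + sigma ^+ 2) by rewrite sqrtr_gt0.
(* Bayes' rule: [m'] and [sigma' ^+ 2] are the mean and variance of x given the value s observed
   with unit noise, so the integrand is a constant times that posterior density. *)
pose sigma' := sigma / Num.sqrt (1 + sigma ^+ 2).
pose m' := (sigma ^+ 2 * s + m) / (1 + sigma ^+ 2).
have s'0 : sigma' != 0 by rewrite mulf_neq0// invr_eq0 gt_eqF.
have s'2 : sigma' ^+ 2 = sigma ^+ 2 / (1 + sigma ^+ 2).
  by rewrite expr_div_n sqr_sqrtr// ltW.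
transitivity (\int[lebesgue_measure]_x
    ((gauss_ratio m sigma s)%:E * (normal_pdf m' sigma' x)%:E))%E.
  apply: eq_integral => x _; rewrite -EFinM; congr (_%:E).
  rewrite !normal_pdfE// mulrCA /gauss_ratio [RHS]mulrACA; congr (_ * _).
    rewrite /normal_peak s'2 -invfM -sqrtrM ?ltW//; congr (Num.sqrt _)^-1.
    by field; rewrite gt_eqF.
  rewrite /normal_fun -!expRD s'2 /m'; congr expR.
  by field; rewrite sigma0 gt_eqF.
rewrite ge0_integralZl ?integral_normal_pdf ?mule1 ?lee_fin//.
- by apply/measurable_EFinP; exact: measurable_normal_pdf.
- by move=> x _; rewrite lee_fin normal_pdf_ge0.
- by rewrite mulr_ge0 ?expR_ge0// invr_ge0 ltW.
Qed.

(** * Moment generating function of a standard normal vector *)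

Section random_vectors.
Context (R : realType) (d : measure_display) (T : measurableType d)
  (P : probability T R) (K : nat).

Lemma Borel_coord (i : 'I_K) (C : set R) : measurable C ->
  Borel [set x : 'cV[R]_K | C (x i ord0)].
Proof.
pose G := [set B : set 'cV[R]_K | open B].
have mc : measurable_fun setT (fun x : g_sigma_algebraType G => x i ord0 : R).
  apply: (measurability _ (RGenOInfty.measurableE R)) => _ [_ [a ->] <-].
  apply: sub_sigma_algebra; rewrite setTI /G/=.
  apply: open_comp; last exact: interval_open.
  by move=> x _; exact: coord_continuous.
by move=> mC; have := mc measurableT C mC; rewrite setTI.
Qed.

Lemma random_vector_coord (X : T -> 'cV[R]_K) (i : 'I_K) :
  random_vector X -> measurable_fun setT (fun w => X w i ord0).
Proof.
by move=> mX _ C mC; rewrite setTI; exact: (mX _ (Borel_coord i mC)).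
Qed.

Context (X : T -> 'cV[R]_K).
Hypotheses (mX : random_vector X) (lawX : has_law_std_normal P X).

(** A pi-system generating the sigma-algebra of the first m coordinates. *)
Definition boxes (m : nat) : set (set T) :=
  [set A | exists C : 'I_K -> set R, [/\ forall i, measurable (C i),
     forall i : 'I_K, (m <= i)%N -> C i = setT & A = [set w | forall i, C i (X w i ord0)]]].

Lemma boxes_setI m : setI_closed (boxes m).
Proof.
move=> A B [C [mC CT ->]] [D [mD DT ->]]; exists (fun i => C i `&` D i); split.
- by move=> i; exact: measurableI.
- by move=> i mi; rewrite CT// DT// setTI.
- by apply/seteqP; split=> [w [h1 h2] i|w h]; [split|split=> i; case: (h i)].
Qed.

Lemma boxes_setT m : boxes m setT.
Proof. by exists (fun=> setT); split=> //; apply/seteqP. Qed.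

Lemma boxes_measurable m : boxes m `<=` measurable.
Proof.
move=> _ [C [mC _ ->]].
rewrite (_ : [set _ | _] = \bigcap_(i in setT) (fun w => X w i ord0) @^-1` C i).
  apply: fin_bigcap_measurable => // i _; rewrite -[X in measurable X]setTI.
  exact: random_vector_coord.
by apply/seteqP; split=> w /= h i; [move=> _|]; apply: h.
Qed.

Lemma law_coord (i : 'I_K) (C : set R) : measurable C ->
  P ((fun w => X w i ord0) @^-1` C) = normal_prob 0 1 C.
Proof.
move=> mC.
have := lawX (C := fun j => if j == i then C else setT).
rewrite (bigD1 i)//= eqxx big1 => [|j /negbTE->]; last exact: probability_setT.
rewrite mule1 => <-; last by move=> j; case: ifP.
congr (P _); apply/seteqP; split=> [w Cw j|w /(_ i)]; last by rewrite eqxx.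
by case: eqVneq => [->|].
Qed.

Lemma boxes_indep (i : 'I_K) A C : boxes i A -> measurable C ->
  P (A `&` (fun w => X w i ord0) @^-1` C) =
  (P A * P ((fun w => X w i ord0) @^-1` C))%E.
Proof.
move=> [D [mD DT ->]] mC; rewrite law_coord//.
have := lawX (C := fun j => if j == i then C else D j).
rewrite lawX// (bigD1 i)//= eqxx => E.
rewrite [X in (X * _)%E](bigD1 i)//= DT// probability_setT mul1e.
rewrite muleC (eq_bigr (fun j => normal_prob 0 1 (if j == i then C else D j))).
  rewrite -E; last by move=> j; case: ifP.
  congr (P _); apply/seteqP; split=> [w [Dw Cw] j|w h].
    by case: eqVneq => [->|].
  split=> [j|]; last by have := h i; rewrite eqxx.
  by have := h j; case: eqVneq => // ->; rewrite DT.
by move=> j /negbTE->.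
Qed.

(** Induction on the number of coordinates: the partial sum is measurable for [<<s boxes m >>], of
    which coordinate m is independent, so that coordinate integrates out as a one-dimensional moment
    generating function. *)
Lemma expectation_exp_coords (u : 'I_K -> R) (m : nat) : (m <= K)%N ->
  (\int[P]_w (expR (\sum_(i < K | (i < m)%N) u i * X w i ord0))%:E =
   (expR (\sum_(i < K | (i < m)%N) u i ^+ 2 / 2))%:E)%E.
Proof.
elim: m => [_|m IH mK].
  rewrite big_pred0//; under eq_integral do rewrite big_pred0//.
  by apply: etrans (integral_cst _ _ _) _ => //; rewrite [X in (_ * X)%E]probability_setT mule1.
pose k : 'I_K := Ordinal mK.
have sumS (F : 'I_K -> R) :
    \sum_(i < K | (i < m.+1)%N) F i = \sum_(i < K | (i < m)%N) F i + F k.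
  rewrite (bigD1 k)//= addrC; congr (_ + _); apply: eq_bigl => i.
  by rewrite ltnS -val_eqE/= ltn_neqAle andbC.
pose S (w : T) := \sum_(i < K | (i < m)%N) u i * X w i ord0.
have mS : measurable_fun setT (S : g_sigma_algebraType (boxes m) -> R).
  rewrite /S; under eq_fun do rewrite big_mkcond/=.
  apply: measurable_sum => i; case: ltnP => im; last exact: measurable_cst.
  apply: measurable_funM => // _ C mC; rewrite setTI.
  apply: sub_sigma_algebra; exists (fun j => if j == i then C else setT); split.
  - by move=> j; case: ifP.
  - by move=> j; case: eqVneq => // ->; rewrite leqNgt im.
  - apply/seteqP; split=> [w Cw j|w /(_ i)]; last by rewrite eqxx.
    by case: eqVneq => [->|].
under eq_integral do rewrite sumS expRD.
rewrite sumS expRD.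
pose f (z : g_sigma_algebraType (boxes m) * R) : \bar R :=
  (expR (S z.1) * expR (u k * z.2))%:E.
have mf : measurable_fun setT f.
  apply/measurable_EFinP/measurable_funM; apply: measurableT_comp => //.
    exact: measurableT_comp.
  exact: measurable_funM.
have f0 z : (0 <= f z)%E by rewrite lee_fin mulr_ge0// expR_ge0.
have ind A C : <<s boxes m >> A -> measurable C ->
    P (A `&` (fun w => X w k ord0) @^-1` C) =
    (P A * P ((fun w => X w k ord0) @^-1` C))%E.
  move=> sA mC; apply: (@indep_g_sigma _ _ _ _ (boxes m)) => //.
  - exact: boxes_setI.
  - exact: boxes_setT.
  - exact: boxes_measurable.
  - by rewrite -[X in measurable X]setTI; exact: random_vector_coord.
  - by move=> B /= bB; exact: (@boxes_indep k).
have := @integral_indep R d T P _ _ (g_sigma_algebraType (boxes m)) R id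
  (fun w => X w k ord0) f (measurable_id_g_sigma (@boxes_measurable m))
  (random_vector_coord k mX) ind mf f0.
rewrite /f/= => ->.
have mXk := random_vector_coord k mX.
have Ek : (\int[P]_w (expR (u k * X w k ord0))%:E = (expR (u k ^+ 2 / 2))%:E)%E.
  rewrite -normal_mgf.
  apply: (integral_law_density (f := fun x => expR (u k * x))) => //.
  - exact: measurable_normal_pdf.
  - exact: normal_pdf_ge0.
  - by move=> C mC; exact: (law_coord k mC).
  - by apply: measurableT_comp => //; exact: measurable_funM.
have mE : measurable_fun setT (fun w => (expR (u k * X w k ord0))%:E).
  by apply/measurable_EFinP; apply: measurableT_comp => //; exact: measurable_funM.
have mES : measurable_fun setT (fun w => (expR (S w))%:E).
  apply/measurable_EFinP; apply: measurableT_comp => //.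
  apply: (measurable_comp _ _ mS (measurable_id_g_sigma (@boxes_measurable m))) => //.
transitivity (\int[P]_w ((expR (S w))%:E * (expR (u k ^+ 2 / 2))%:E))%E.
  by apply: eq_integral => w _; rewrite -Ek -ge0_integralZl.
by rewrite ge0_integralZr// IH// ltnW.
Qed.

End random_vectors.

Lemma gauss_ratio_ge0 (R : realType) (m sigma s : R) : 0 <= gauss_ratio m sigma s.
Proof. by rewrite mulr_ge0 ?expR_ge0// invr_ge0 sqrtr_ge0. Qed.

Lemma measurable_gauss_ratio (R : realType) (m sigma : R) :
  measurable_fun setT (gauss_ratio m sigma).
Proof.
apply: measurable_funM => //; apply: measurableT_comp => //.
apply: measurable_funB; apply: measurable_funM => //.
by apply: measurable_funX; exact: measurable_funB.
Qed.

(** * Mean of a product of Gaussian ratios in rotated coordinates *)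

Section gaussian_expectation.
Context (R : realType) (d : measure_display) (T : measurableType d)
  (P : probability T R) (K : nat) (X : T -> 'cV[R]_K).
Hypotheses (mX : random_vector X) (lawX : has_law_std_normal P X).
Context (V : 'M[R]_K) (VV : V *m V^T = 1%:M).

Let Z (i : 'I_K) (w : T) : R := (V *m X w) i ord0.

Let mZ i : measurable_fun setT (Z i).
Proof.
rewrite /Z; under eq_fun do rewrite mxE.
apply: measurable_sum => j; apply: measurable_funM => //.
exact: random_vector_coord.
Qed.

(** The logarithm of the ratio of the N(u, I) density to the N(0, I) density at [V *m X w]. *)
Let lin (u : 'I_K -> R) (w : T) := \sum_i u i * Z i w - (\sum_i u i ^+ 2) / 2.

Let mlin u : measurable_fun setT (lin u).
Proof.
apply: measurable_funB => //; apply: measurable_sum => i.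
exact: measurable_funM.
Qed.

(** The rotation passes to the coefficients: pairing u with V X is pairing u V with X, and u V has
    the norm of u. So the moment generating function of [X] itself suffices. *)
Lemma expectation_exp_lin u : (\int[P]_w (expR (lin u w))%:E = 1)%E.
Proof.
pose r : 'rV[R]_K := \row_i u i; pose c j := (r *m V) ord0 j.
have cX w : \sum_i u i * Z i w = \sum_(j < K | (j < K)%N) c j * X w j ord0.
  have : (r *m (V *m X w)) ord0 ord0 = (r *m V *m X w) ord0 ord0 by rewrite mulmxA.
  rewrite [LHS]mxE [RHS]mxE => E; transitivity (\sum_j r ord0 j * Z j w).
    by apply: eq_bigr => j _; rewrite mxE.
  by rewrite E; apply: eq_bigl => j; rewrite ltn_ord.
have c2 : \sum_(j < K | (j < K)%N) c j ^+ 2 / 2 = (\sum_i u i ^+ 2) / 2.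
  rewrite -mulr_suml; congr (_ / 2).
  have : (r *m V *m (r *m V)^T) ord0 ord0 = (r *m r^T) ord0 ord0.
    by rewrite trmx_mul !mulmxA -(mulmxA r) VV mulmx1.
  rewrite [LHS]mxE [RHS]mxE => E.
  transitivity (\sum_j (r *m V) ord0 j * (r *m V)^T j ord0).
    apply: eq_big => [j|j _]; first by rewrite ltn_ord.
    by rewrite [X in _ = _ * X]mxE expr2.
  by rewrite E; apply: eq_bigr => j _; rewrite !mxE expr2.
transitivity (\int[P]_w ((expR (\sum_(j < K | (j < K)%N) c j * X w j ord0))%:E *
   (expR (- ((\sum_i u i ^+ 2) / 2)))%:E))%E.
  by apply: eq_integral => w _; rewrite -EFinM -expRD -cX.
rewrite ge0_integralZr//; last first.
  apply/measurable_EFinP; apply: measurableT_comp => //.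
  under eq_fun do rewrite -cX; apply: measurable_sum => i.
  exact: measurable_funM.
by rewrite expectation_exp_coords// c2 -EFinM -expRD subrr expR0.
Qed.

(* The ratio in the direction a is an average over x of exponentials, each of
   which moves u to u + x e_a and leaves u zero on the remaining directions. *)
Lemma expectation_gauss_ratios (m sigma : 'I_K -> R) (s : seq 'I_K)
    (u : 'I_K -> R) :
  (forall i, sigma i != 0) -> uniq s -> (forall i, i \in s -> u i = 0) ->
  (\int[P]_w (expR (lin u w) *
     \prod_(i <- s) gauss_ratio (m i) (sigma i) (Z i w))%:E = 1)%E.
Proof.
move=> sigma0; elim: s u => [u _ _|a s IH u /= /andP[as_ us] u0].
  under eq_integral do rewrite big_nil mulr1.
  exact: expectation_exp_lin.
pose ux (x : R) i := if i == a then x else u i.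
have linux x w : lin (ux x) w = lin u w + (x * Z a w - x ^+ 2 / 2).
  rewrite /lin [in LHS](bigD1 a)//= [in LHS](bigD1 a (F := fun i => ux x i ^+ 2))//=.
  rewrite [in RHS](bigD1 a)//= [in RHS](bigD1 a (F := fun i => u i ^+ 2))//=.
  rewrite (u0 a) ?mem_head// /ux eqxx.
  rewrite (eq_bigr (fun i => u i * Z i w)) => [|i /negbTE->//].
  rewrite [X in _ - (_ + X) / 2](eq_bigr (fun i => u i ^+ 2)) => [|i /negbTE->//].
  by field.
pose Q w := \prod_(i <- s) gauss_ratio (m i) (sigma i) (Z i w).
have mQ : measurable_fun setT Q.
  apply: measurable_prod => i _; apply: measurableT_comp => //.
  exact: measurable_gauss_ratio.
have Q0 w : 0 <= Q w by apply: prodr_ge0 => i _; exact: gauss_ratio_ge0.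
pose F (z : T * R) :=
  (expR (lin (ux z.2) z.1) * Q z.1 * normal_pdf (m a) (sigma a) z.2)%:E.
have F0 z : (0 <= F z)%E.
  by rewrite lee_fin !mulr_ge0 ?normal_pdf_ge0 ?expR_ge0.
have mF : measurable_fun setT F.
  apply/measurable_EFinP; apply: measurable_funM; last first.
    by apply: measurableT_comp => //; exact: measurable_normal_pdf.
  apply: measurable_funM; last exact: measurableT_comp.
  apply: measurableT_comp => //; under eq_fun do rewrite linux.
  apply: measurable_funD; first exact: measurableT_comp.
  apply: measurable_funB; apply: measurable_funM => //.
    exact: (@measurableT_comp _ _ _ _ _ _ (Z a)).
  exact: measurable_funX.
transitivity (\int[P]_w \int[lebesgue_measure]_x F (w, x))%E.
  apply: eq_integral => w _; rewrite big_cons mulrCA -/(Q w) mulrC EFinM.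
  have mE : measurable_fun setT (fun x : R =>
      (expR (x * Z a w - x ^+ 2 / 2) * normal_pdf (m a) (sigma a) x)%:E).
    apply/measurable_EFinP/measurable_funM; last exact: measurable_normal_pdf.
    by apply: measurableT_comp => //; apply: measurable_funB; apply: measurable_funM.
  rewrite -gauss_ratioE// -ge0_integralZl//; last 2 first.
  - by move=> x _; rewrite lee_fin mulr_ge0 ?expR_ge0 ?normal_pdf_ge0.
  - by rewrite lee_fin mulr_ge0 ?expR_ge0.
  apply: eq_integral => x _; rewrite /F/= -EFinM; congr (_%:E).
  by rewrite linux (expRD (lin u w)); ring.
have := @fubini_tonelli _ _ _ _ _ P lebesgue_measure _ mF F0.
move=> /= ->; rewrite -[RHS](integral_normal_pdf (m a) (sigma a)).
apply: eq_integral => x _; rewrite /F/=.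
transitivity (\int[P]_w ((expR (lin (ux x) w) * Q w)%:E *
    (normal_pdf (m a) (sigma a) x)%:E))%E.
  by apply: eq_integral => w _; rewrite EFinM.
rewrite ge0_integralZr//; last 3 first.
- by apply/measurable_EFinP/measurable_funM => //; exact: measurableT_comp.
- by move=> w _; rewrite lee_fin mulr_ge0 ?expR_ge0.
- by rewrite lee_fin normal_pdf_ge0.
rewrite IH ?mul1e// => i si; rewrite /ux; case: eqVneq => [ia|_].
  by rewrite -ia si in as_.
by rewrite u0// inE si orbT.
Qed.

End gaussian_expectation.

(** * Factorisation of the likelihood ratio *)

Lemma sqrtr_prod (R : rcfType) (I : finType) (f : I -> R) :
  (forall i, 0 <= f i) -> Num.sqrt (\prod_i f i) = \prod_i Num.sqrt (f i).
Proof.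
move=> f0; suff [] : Num.sqrt (\prod_i f i) = \prod_i Num.sqrt (f i) /\ 0 <= \prod_i f i by [].
elim/big_rec2: _ => [|i x y _ [<- y0]]; first by rewrite sqrtr1.
by rewrite sqrtrM// mulr_ge0.
Qed.

Lemma std_normal_pdfE (R : realType) (K : nat) (y : 'cV[R]_K) :
  std_normal_pdf y =
  (\prod_(i < K) (Num.sqrt (2 * pi))^-1) * expR (- ((y^T *m y) ord0 ord0 / 2)).
Proof.
rewrite mxE mulr_suml -sumrN expR_sum -big_split/=; apply: eq_bigr => i _.
rewrite normal_pdfE ?oner_eq0// /normal_peak /normal_fun !mxE subr0 expr1n mul1r.
by rewrite -(mulr_natl pi) -expr2 mulNr.
Qed.

Lemma mul_spmx (R : realType) (K : nat) (V : 'M[R]_K) d (x : 'cV[R]_K) i :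
  V *m V^T = 1%:M -> (V *m (spmx V d *m x)) i ord0 = d i * (V *m x) i ord0.
Proof.
move=> VV; rewrite /spmx !mulmxA VV mul1mx -mulmxA mul_diag_mx.
by rewrite mxE mxE.
Qed.

Lemma likelihood_ratioE (R : realType) (K : nat) (A Rw Sigma : 'M[R]_K)
    (mu y : 'cV[R]_K) (V : 'M[R]_K) (lam : 'I_K -> R) :
  V *m V^T = 1%:M -> (forall i, 0 < lam i) ->
  let M := A *m Sigma *m A^T + Rw in
  M = spmx V lam ->
  expR (H A Rw Sigma mu y - ln (std_normal_pdf y)) =
  \prod_(i < K) gauss_ratio ((V *m ((M + 1%:M) *m (mu - Sigma *m y))) i ord0)
    (Num.sqrt (lam i)) ((V *m y) i ord0).
Proof.
move=> VV lam0 M ME.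
rewrite /H -/M; set v := (M + 1%:M) *m _.
have invM : invmx M = spmx V (fun i => (lam i)^-1).
  by rewrite ME invmx_spmx// => i; rewrite gt_eqF.
have NE : invmx M + 1%:M = spmx V (fun i => (lam i)^-1 + 1).
  by rewrite invM (spmx_cst VV) spmxD.
have n0 i : 0 < (lam i)^-1 + 1 by rewrite addr_gt0// invr_gt0.
have l1 i : 0 < 1 + lam i by rewrite addr_gt0.
have invN : invmx (invmx M + 1%:M) = spmx V (fun i => ((lam i)^-1 + 1)^-1).
  by rewrite NE invmx_spmx// => i; rewrite gt_eqF.
rewrite invN NE; set w := invmx M *m v + y.
have wE i : (V *m w) i ord0 = (lam i)^-1 * (V *m v) i ord0 + (V *m y) i ord0.
  by rewrite /w mulmxDr mxE invM mul_spmx.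
have yE : (y^T *m y) ord0 ord0 = \sum_i ((V *m y) i ord0) ^+ 2.
  rewrite -[y^T in LHS]mulmx1 (spmx_cst VV) quad_spmx.
  by apply: eq_bigr => i _; rewrite mul1r.
rewrite invM !quad_spmx.
have p2 : 0 < 2 * pi :> R by rewrite mulr_gt0// pi_gt0.
(* For each eigenvalue, [lam i * ((lam i)^-1 + 1) = 1 + lam i]: the two determinants combine into
   that of M + I. *)
have cE : (Num.sqrt ((2 * pi) ^+ K * \det M))^-1 *
    (Num.sqrt (\det (spmx V (fun i => (lam i)^-1 + 1))))^-1 =
    (\prod_(i < K) (Num.sqrt (2 * pi))^-1) * \prod_i (Num.sqrt (1 + lam i))^-1.
  rewrite -invfM -sqrtrM; last first.
    by rewrite mulr_ge0 ?exprn_ge0 ?ltW// ME det_spmx// prodr_gt0.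
  rewrite ME !det_spmx// -{1}(card_ord K) -prodr_const -mulrA -!big_split/=.
  rewrite sqrtr_prod; last first.
    by move=> i; rewrite (mulr_ge0 (ltW p2))// mulr_ge0 ?ltW.
  rewrite -prodfV; apply: eq_bigr => i _.
  rewrite -invfM -sqrtrM ?ltW//; congr (Num.sqrt (_ * _))^-1.
  by rewrite mulrDr mulr1 mulfV ?gt_eqF.
rewrite cE std_normal_pdfE.
under [RHS]eq_bigr do rewrite /gauss_ratio sqr_sqrtr ?ltW//.
rewrite big_split/= -expR_sum.
set a := \prod_(i < K) (Num.sqrt (2 * pi))^-1.
set b := \prod_(i < K) (Num.sqrt (1 + lam i))^-1.
have a0 : 0 < a by apply: prodr_gt0 => i _; rewrite invr_gt0 sqrtr_gt0.
have b0 : 0 < b by apply: prodr_gt0 => i _; rewrite invr_gt0 sqrtr_gt0.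
rewrite !lnM ?posrE ?expR_gt0// expRK yE.
rewrite -[b in RHS]lnK ?posrE// -expRD; congr expR.
have -> : \sum_i (((V *m y) i ord0) ^+ 2 / 2 -
      ((V *m y) i ord0 - (V *m v) i ord0) ^+ 2 / (2 * (1 + lam i))) =
    2^-1 * (\sum_i ((lam i)^-1 + 1)^-1 * (V *m w) i ord0 ^+ 2 -
            \sum_i (lam i)^-1 * (V *m v) i ord0 ^+ 2).
  rewrite -sumrB mulr_sumr; apply: eq_bigr => i _; rewrite wE.
  by field; rewrite !gt_eqF.
by ring.
Qed.

(** * Measurability and differentiability of matrix expressions *)

Section entrywise.
Context (R : comNzRingType) (T : Type) (Q : (T -> R) -> Prop).

(* Q is instantiated both with measurability and with derivability at 0. *)
Definition ring_closed : Prop :=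
  [/\ forall c, Q (fun=> c),
      forall f g, Q f -> Q g -> Q (fun x => f x + g x)
    & forall f g, Q f -> Q g -> Q (fun x => f x * g x)].

Definition entrywise m n (F : T -> 'M[R]_(m, n)) : Prop :=
  forall i j, Q (fun x => F x i j).

Hypothesis QP : ring_closed.

Let Qc c : Q (fun=> c). Proof. by case: QP. Qed.
Let QD f g : Q f -> Q g -> Q (fun x => f x + g x).
Proof. by case: QP => _ + _; apply. Qed.
Let QM f g : Q f -> Q g -> Q (fun x => f x * g x).
Proof. by case: QP => _ _; apply. Qed.

Lemma closed_sum I (s : seq I) (p : pred I) (f : I -> T -> R) :
  (forall i, Q (f i)) -> Q (fun x => \sum_(i <- s | p i) f i x).
Proof.
move=> Qf; elim: s => [|i s IH]; first by under eq_fun do rewrite big_nil; exact: Qc.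
under eq_fun do rewrite big_cons.
by case: (p i) => //; exact: QD.
Qed.

Lemma closed_prod I (s : seq I) (p : pred I) (f : I -> T -> R) :
  (forall i, Q (f i)) -> Q (fun x => \prod_(i <- s | p i) f i x).
Proof.
move=> Qf; elim: s => [|i s IH]; first by under eq_fun do rewrite big_nil; exact: Qc.
under eq_fun do rewrite big_cons.
by case: (p i) => //; exact: QM.
Qed.

Lemma closed_scale c f : Q f -> Q (fun x => c * f x).
Proof. exact: QM. Qed.

Lemma closed_sub f g : Q f -> Q g -> Q (fun x => f x - g x).
Proof.
move=> Qf Qg; under eq_fun do rewrite -mulN1r.
by apply: QD => //; exact: closed_scale.
Qed.

Lemma entrywise_cst m n (A : 'M[R]_(m, n)) : entrywise (fun=> A).
Proof. by move=> i j; exact: Qc. Qed.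

Lemma entrywiseD m n (F G : T -> 'M[R]_(m, n)) :
  entrywise F -> entrywise G -> entrywise (fun x => F x + G x).
Proof. by move=> QF QG i j; under eq_fun do rewrite mxE; exact: QD. Qed.

Lemma entrywiseB m n (F G : T -> 'M[R]_(m, n)) :
  entrywise F -> entrywise G -> entrywise (fun x => F x - G x).
Proof. by move=> QF QG i j; under eq_fun do rewrite mxE mxE; exact: closed_sub. Qed.

Lemma entrywiseZ m n (f : T -> R) (F : T -> 'M[R]_(m, n)) :
  Q f -> entrywise F -> entrywise (fun x => f x *: F x).
Proof. by move=> Qf QF i j; under eq_fun do rewrite mxE; exact: QM. Qed.

Lemma entrywiseM m n p (F : T -> 'M[R]_(m, n)) (G : T -> 'M[R]_(n, p)) :
  entrywise F -> entrywise G -> entrywise (fun x => F x *m G x).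
Proof.
move=> QF QG i j; under eq_fun do rewrite mxE.
by apply: closed_sum => k; exact: QM.
Qed.

Lemma entrywiseT m n (F : T -> 'M[R]_(m, n)) :
  entrywise F -> entrywise (fun x => (F x)^T).
Proof. by move=> QF i j; under eq_fun do rewrite mxE; exact: QF. Qed.

Lemma entrywise_det n (F : T -> 'M[R]_n) : entrywise F -> Q (fun x => \det (F x)).
Proof.
move=> QF; apply: closed_sum => s; apply: closed_scale.
by apply: closed_prod => i; exact: QF.
Qed.

Lemma entrywise_tr n (F : T -> 'M[R]_n) : entrywise F -> Q (fun x => \tr (F x)).
Proof. by move=> QF; apply: closed_sum => i; exact: QF. Qed.

Lemma entrywise_adj n (F : T -> 'M[R]_n) : entrywise F -> entrywise (fun x => \adj (F x)).
Proof.
move=> QF i j; under eq_fun do rewrite mxE; apply: closed_scale.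
by apply: entrywise_det => a b; under eq_fun do rewrite !mxE; exact: QF.
Qed.

End entrywise.

Section measurability.
Context (R : realType) (d : measure_display) (T : measurableType d).

Lemma measurable_inv : measurable_fun setT (fun x : R => x^-1).
Proof.
(* These functions are continuous on the whole line; at 0 they vanish, in accordance with the
   convention [0^-1 = 0]. *)
apply: (@measurable_fun_cvg _ R R setT (fun n x => x / (x ^+ 2 + n.+1%:R^-1))).
  move=> n; apply: continuous_measurable_fun => x.
  have x0 : x ^+ 2 + n.+1%:R^-1 != 0 by rewrite gt_eqF// ltr_wpDl ?sqr_ge0.
  apply: cvgM; first exact: cvg_id.
  apply: cvgV => //; apply: cvgD; last exact: cvg_cst.
  exact: exprn_continuous.
move=> x _; have [->|x0] := eqVneq x 0.
  by under eq_fun do rewrite mul0r; rewrite invr0; exact: cvg_cst.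
rewrite -[X in _ --> X](_ : x / (x ^+ 2 + 0) = x^-1); last first.
  by rewrite addr0; field.
apply: cvgMr; apply: cvgV; first by rewrite addr0 expf_neq0.
by apply: cvgD; [exact: cvg_cst|exact: cvg_harmonic].
Qed.

Definition meas (f : T -> R) : Prop := measurable_fun setT f.

Lemma meas_ring_closed : ring_closed meas.
Proof.
split=> [c|f g mf mg|f g mf mg]; first exact: measurable_cst.
- exact: measurable_funD.
- exact: measurable_funM.
Qed.

Definition mxmeas m n (F : T -> 'M[R]_(m, n)) : Prop := entrywise meas F.

Lemma mxmeas_inv n (F : T -> 'M[R]_n) : mxmeas F -> mxmeas (fun x => invmx (F x)).
Proof.
move=> mF i j.
have md := entrywise_det meas_ring_closed mF.
(* Cramer's formula where the determinant is nonzero; elsewhere [invmx] returns its argument. *)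
rewrite /meas (_ : (fun x => _) = fun x =>
    if \det (F x) == 0 then F x i j else (\det (F x))^-1 * \adj (F x) i j).
  apply: measurable_fun_ifT => //.
  - exact: measurable_fun_eqr.
  - exact: mF.
  - apply: measurable_funM; first exact: (measurableT_comp measurable_inv).
    exact: (entrywise_adj meas_ring_closed mF).
apply/funext => x; rewrite /invmx unitmxE unitfE; case: eqP => //= _.
by rewrite mxE.
Qed.

Lemma measurable_std_normal_pdf K (y : T -> 'cV[R]_K) :
  mxmeas y -> meas (fun w => std_normal_pdf (y w)).
Proof.
move=> my; apply: measurable_prod => i _.
by apply: (measurableT_comp (measurable_normal_pdf 0 1)); exact: my.
Qed.

Lemma measurable_H K (A Rw Sigma : T -> 'M[R]_K) (mu y : T -> 'cV[R]_K) :
  mxmeas A -> mxmeas Rw -> mxmeas Sigma -> mxmeas mu -> mxmeas y ->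
  meas (fun w => H (A w) (Rw w) (Sigma w) (mu w) (y w)).
Proof.
move=> mA mR mS mmu my; have Qm := meas_ring_closed.
have mM : mxmeas (fun w => A w *m Sigma w *m (A w)^T + Rw w).
  by repeat (apply: entrywiseD || apply: entrywiseM || apply: entrywiseT).
have mv : mxmeas (fun w => (A w *m Sigma w *m (A w)^T + Rw w + 1%:M) *m
    (mu w - Sigma w *m y w)).
  apply: entrywiseM => //; first by apply: entrywiseD => //; exact: entrywise_cst.
  by apply: entrywiseB => //; exact: entrywiseM.
move: mM mv; rewrite /H; set M := fun w => _ + Rw w; set v := fun w => _ *m _.
move=> mM mv.
have mN : mxmeas (fun w => invmx (M w) + 1%:M).
  by apply: entrywiseD => //; [exact: mxmeas_inv|exact: entrywise_cst].
have mw : mxmeas (fun w => invmx (M w) *m v w + y w).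
  by apply: entrywiseD => //; apply: entrywiseM => //; exact: mxmeas_inv.
have msqrt : measurable_fun setT (@Num.sqrt R).
  by apply: continuous_measurable_fun; exact: sqrt_continuous.
apply: measurable_funB.
  apply: (measurableT_comp (@measurable_ln R)); apply: measurable_funM.
    apply: (measurableT_comp measurable_inv); apply: (measurableT_comp msqrt).
    by apply: measurable_funM => //; exact: (entrywise_det Qm mM).
  apply: (measurableT_comp measurable_inv); apply: (measurableT_comp msqrt).
  exact: (entrywise_det Qm mN).
apply: measurable_funM => //; apply: measurable_funB; last first.
  apply: (_ : mxmeas (fun w => _)); apply: entrywiseM => //.
  apply: entrywiseM => //; first exact: entrywiseT.
  exact: mxmeas_inv.
apply: measurable_funD.
  apply: (_ : mxmeas (fun w => _)); apply: entrywiseM => //.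
  apply: entrywiseM => //; first exact: entrywiseT.
  exact: mxmeas_inv.
apply: (_ : mxmeas (fun w => _)); apply: entrywiseM => //.
exact: entrywiseT.
Qed.

Lemma measurable_Proj K (eps : R) (X : T -> 'M[R]_K) :
  (forall w, (X w)^T = X w) -> mxmeas X -> mxmeas (fun w => Proj eps (X w)).
Proof.
move=> XT mX i j; have Qm := meas_ring_closed.
apply: (measurable_fun_cvg (h := fun n w => clip_approx eps (X w) n i j)); last first.
  by move=> w _; apply: cvg_clip_approx; exact: Proj_clip.
move=> n.
have mZ : mxmeas (fun w => X w - eps%:M).
  by apply: entrywiseB => //; exact: entrywise_cst.
have mr : mxmeas (fun w => 1%:M - (1 + \tr ((X w - eps%:M) *m (X w - eps%:M)))^-1 *:
    (X w - eps%:M)).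
  apply: entrywiseB => //; first exact: entrywise_cst.
  apply: entrywiseZ => //; apply: (measurableT_comp measurable_inv).
  by apply: measurable_funD => //; apply: entrywise_tr => //; exact: entrywiseM.
suff : mxmeas (fun w => clip_approx eps (X w) n) by apply.
apply: entrywiseD => //; last exact: entrywise_cst.
apply: entrywiseM => //; apply: mxmeas_inv; apply: entrywiseD => //.
  exact: entrywise_cst.
elim: n => [|n IH]; first exact: entrywise_cst.
exact: (entrywiseM Qm mr IH).
Qed.

(** Along the steps [n.+1%:R^-1] the derivative is a pointwise limit of difference quotients. Since
    [f w] itself varies with w, measurability is asked along every measurable matrix [B]. *)
Lemma measurable_derive (K : nat) (f : T -> 'M[R]_K -> R) (A : T -> 'M[R]_K)
    (v : 'M[R]_K) :
  mxmeas A ->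
  (forall B : T -> 'M[R]_K, mxmeas B -> meas (fun w => f w (B w))) ->
  (forall w, derivable (f w) (A w) v) ->
  meas (fun w => 'D_v (f w) (A w)).
Proof.
move=> mA mf df; have Qm := meas_ring_closed.
apply: (measurable_fun_cvg (h := fun n w =>
    (n.+1%:R^-1)^-1 *: (f w (n.+1%:R^-1 *: v + A w) - f w (A w)))).
  move=> n; apply: measurable_funM => //; apply: measurable_funB.
    by apply: (mf (fun w => n.+1%:R^-1 *: v + A w)); apply: entrywiseD => //; exact: entrywise_cst.
  exact: mf.
move=> w _.
have := df w; rewrite /derivable /derive => /cvg_ex[l fl].
rewrite (cvg_lim _ fl)//.
move/cvgr_dnbhsP: fl => fl; apply: (fl (fun n => n.+1%:R^-1)); split.
  by move=> n; rewrite invr_neq0.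
exact: cvg_harmonic.
Qed.

End measurability.

Section derivability.
Context (R : realType).

(** A directional derivative of a matrix function at X along E is the derivative at 0 of its
    restriction to the line [h *: E + X]; everything is done on that line. *)
Definition der0 (f : R -> R) : Prop := derivable f 0 1.

Lemma der0_ring_closed : ring_closed der0.
Proof.
split=> [c|f g df dg|f g df dg].
- exact: derivable_cst.
- exact: (derivableD df dg).
- exact: (derivableM df dg).
Qed.

Lemma der0_comp (g f : R -> R) :
  derivable g (f 0) 1 -> der0 f -> der0 (fun h => g (f h)).
Proof.
move=> /derivable1_diffP dg /derivable1_diffP df.
by apply/derivable1_diffP; exact: (@differentiable_comp _ _ _ _ f g).
Qed.

Lemma der0_neq0 f : der0 f -> f 0 != 0 -> \forall h \near (0 : R), f h != 0.
Proof.
move=> /derivable1_diffP/differentiable_continuous cf f0.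
exact: (@cvgr_neq0 _ _ _ _ _ f (f 0) cf f0).
Qed.

Definition mxder m n (F : R -> 'M[R]_(m, n)) : Prop := entrywise der0 F.

Lemma mxder_inv n (F : R -> 'M[R]_n) :
  F 0 \in unitmx -> mxder F -> mxder (fun h => invmx (F h)).
Proof.
rewrite unitmxE unitfE => F0 dF i j; have Qd := der0_ring_closed.
have dd := entrywise_det Qd dF.
apply: (@near_eq_derivable _ _ _ (fun h => (\det (F h))^-1 * \adj (F h) i j)).
  (* The determinant is nonzero at 0, hence nearby, so Cramer's formula holds in a neighbourhood,
     which is enough for the derivative. *)
  near=> h; rewrite /invmx unitmxE unitfE.
  have -> : \det (F h) != 0 by near: h; exact: der0_neq0.
  by rewrite [RHS]mxE.
apply: derivableM; first exact: derivableV.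
exact: (entrywise_adj Qd dF).
Unshelve. all: by end_near. Qed.

Lemma der0_sqrt f : der0 f -> 0 < f 0 -> der0 (fun h => Num.sqrt (f h)).
Proof.
move=> df f0; apply: der0_comp df.
by have [] := is_derive1_sqrt f0.
Qed.

Lemma der0_ln f : der0 f -> 0 < f 0 -> der0 (fun h => ln (f h)).
Proof.
move=> df f0; apply: der0_comp df.
by have [] := is_derive1_ln f0.
Qed.

(** Positive definiteness at h = 0 makes the matrices to be inverted regular there and the arguments
    of the square roots and of the logarithm positive. *)
Lemma der0_H K (A Rw : R -> 'M[R]_K) (Sigma : 'M[R]_K) (mu y : 'cV[R]_K) :
  mxder A -> mxder Rw -> posdef Sigma -> posdef (Rw 0) ->
  der0 (fun h => H (A h) (Rw h) Sigma mu y).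
Proof.
move=> dA dR Spos Rpos; have Qd := der0_ring_closed.
have dcst m n (C : 'M[R]_(m, n)) : mxder (fun=> C) := entrywise_cst Qd C.
have dM : mxder (fun h => A h *m Sigma *m (A h)^T + Rw h) :=
  entrywiseD Qd (entrywiseM Qd (entrywiseM Qd dA (dcst _ _ Sigma)) (entrywiseT dA)) dR.
have Mpos : posdef (A 0 *m Sigma *m (A 0)^T + Rw 0) by exact: posdef_predict.
have dv : mxder (fun h => (A h *m Sigma *m (A h)^T + Rw h + 1%:M) *m
    (mu - Sigma *m y)) :=
  entrywiseM Qd (entrywiseD Qd dM (dcst _ _ 1%:M)) (dcst _ _ (mu - Sigma *m y)).
move: dM dv Mpos; rewrite /H.
set M := fun h => _ + Rw h; set v := fun w => _ *m _.
move=> dM dv Mpos.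
have dM' : mxder (fun h => invmx (M h)).
  apply: mxder_inv => //; rewrite unitmxE unitfE gt_eqF//.
  exact: (posdef_det_gt0 Mpos).
have Npos : posdef (invmx (M 0) + 1%:M) by exact/posdef_add1/posdef_inv.
have dN : mxder (fun h => invmx (M h) + 1%:M) := entrywiseD Qd dM' (dcst _ _ 1%:M).
have dN' : mxder (fun h => invmx (invmx (M h) + 1%:M)).
  apply: mxder_inv => //; rewrite unitmxE unitfE gt_eqF//.
  exact: (posdef_det_gt0 Npos).
have dw : mxder (fun h => invmx (M h) *m v h + y) :=
  entrywiseD Qd (entrywiseM Qd dM' dv) (dcst _ _ y).
have p2 : 0 < (2 * pi) ^+ K :> R by rewrite exprn_gt0// mulr_gt0// pi_gt0.
have c1 : 0 < (2 * pi) ^+ K * \det (M 0) by rewrite mulr_gt0// posdef_det_gt0.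
have c2 := posdef_det_gt0 Npos.
apply: (closed_sub Qd).
  apply: (@der0_ln (fun h => (Num.sqrt ((2 * pi) ^+ K * \det (M h)))^-1 *
    (Num.sqrt (\det (invmx (M h) + 1%:M)))^-1)); last first.
    by rewrite mulr_gt0// invr_gt0 sqrtr_gt0.
  apply: derivableM; apply: derivableV; rewrite ?gt_eqF ?sqrtr_gt0//.
    apply: der0_sqrt => //; apply: (closed_scale Qd).
    exact: (entrywise_det Qd dM).
  by apply: der0_sqrt => //; exact: (entrywise_det Qd dN).
apply: (closed_scale Qd); apply: (closed_sub Qd); last first.
  exact: (entrywiseM Qd (entrywiseM Qd (entrywiseT dw) dN') dw).
have dq : mxder (fun h => (v h)^T *m invmx (M h) *m v h + y^T *m y) :=
  entrywiseD Qd (entrywiseM Qd (entrywiseM Qd (entrywiseT dv) dM') dv)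
    (dcst _ _ (y^T *m y)).
by have := dq ord0 ord0; under eq_fun do rewrite mxE.
Qed.

Lemma mxder_line m n (X E : 'M[R]_(m, n)) : mxder (fun h => h *: E + X).
Proof.
have Qd := der0_ring_closed.
have did : der0 id by exact: derivable_id.
exact: (entrywiseD Qd (entrywiseZ Qd did (entrywise_cst Qd E)) (entrywise_cst Qd X)).
Qed.

Lemma derivable_H_A K (A Rw Sigma E : 'M[R]_K) (mu y : 'cV[R]_K) :
  posdef Sigma -> posdef Rw -> derivable (fun X => H X Rw Sigma mu y) A E.
Proof.
move=> Spos Rpos; apply/derivable1P.
apply: (@der0_H _ (fun h => h *: E + A) (fun=> Rw)) => //.
  exact: mxder_line.
exact: (entrywise_cst der0_ring_closed).
Qed.

Lemma derivable_H_R K (A Rw Sigma E : 'M[R]_K) (mu y : 'cV[R]_K) :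
  posdef Sigma -> posdef Rw -> derivable (fun X => H A X Sigma mu y) Rw E.
Proof.
move=> Spos Rpos; apply/derivable1P.
apply: (@der0_H _ (fun=> A) (fun h => h *: E + Rw)) => //.
- exact: (entrywise_cst der0_ring_closed).
- exact: mxder_line.
- by rewrite scale0r add0r.
Qed.

End derivability.

(** * The OGA-CuSum recursion *)

Section oga.
Context (R : realType) (K : nat) (beta eps : R) (A0 R0 : 'M[R]_K).
Hypotheses (eps_gt0 : 0 < eps) (R0_posdef : posdef R0).

(** The invariant of the recursion. The last clause holds because [st_S] and the logarithm of [st_L]
    receive the same increments and are reset together. *)
Definition good_state (s : oga_state R K) : Prop :=
  [/\ posdef (st_Sigma s), posdef (st_R s), 0 < st_L s & st_S s = ln (st_L s)].

Definition pred_cov (s : oga_state R K) : 'M[R]_K :=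
  st_A s *m st_Sigma s *m (st_A s)^T + st_R s.

Definition filt_cov (s : oga_state R K) : 'M[R]_K :=
  pred_cov s *m invmx (pred_cov s + 1%:M).

Definition filt_mean (s : oga_state R K) (y : 'cV[R]_K) : 'cV[R]_K :=
  invmx (pred_cov s + 1%:M) *m st_A s *m st_mu s + filt_cov s *m y.

Definition step_ratio (s : oga_state R K) (y : 'cV[R]_K) : R :=
  expR (H (st_A s) (st_R s) (filt_cov s) (filt_mean s y) y - ln (std_normal_pdf y)).

Definition step_stat (s : oga_state R K) (y : 'cV[R]_K) : R :=
  st_S s + ln (expR (ln (st_L s) + H (st_A s) (st_R s) (filt_cov s) (filt_mean s y) y
                  - ln (std_normal_pdf y))) - ln (st_L s).

Lemma filt_cov_posdef s : good_state s -> posdef (filt_cov s).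
Proof. by move=> [Sp Rp _ _]; exact/posdef_filter/posdef_predict. Qed.

Lemma good_step s y : good_state s -> good_state (oga_step beta eps A0 R0 s y).
Proof.
move=> gs; have Sp := filt_cov_posdef gs; have [_ Rp L0 SE] := gs.
rewrite /oga_step; case: ifPn => _; split=> //=.
- by rewrite ln1.
(* The directions in [sym_grad] are symmetric in i and j, so the argument of [Proj] is a symmetric
   matrix and has a genuine clipping. *)
- apply: Proj_posdef => //; rewrite linearD linearZ/= Rp.1; congr (_ + _ *: _).
  apply/matrixP => i j; rewrite !mxE; congr ('D_(2^-1 *: _) _ _).
  by rewrite addrC.
- exact: expR_gt0.
- by rewrite SE addrC addKr.
Qed.

Lemma step_statE s y : good_state s ->
  expR (st_S (oga_step beta eps A0 R0 s y)) =
  Num.max 1 (expR (st_S s) * step_ratio s y).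
Proof.
move=> [_ _ _ SE].
have E : expR (step_stat s y) = expR (st_S s) * step_ratio s y.
  by rewrite /step_stat /step_ratio expRK SE -expRD; congr expR; ring.
rewrite -E -/(step_stat s y).
have -> : st_S (oga_step beta eps A0 R0 s y) = Num.max 0 (step_stat s y).
  rewrite /oga_step -/(pred_cov s) -/(filt_cov s) -/(filt_mean s y) -/(step_stat s y).
  by case: ltP.
have [S0|S0] := leP 0 (step_stat s y).
  by rewrite max_r// -expR0 ler_expR.
by rewrite expR0 max_l// -expR0 ler_expR ltW.
Qed.

Section expectation.
Context (d : measure_display) (T : measurableType d) (P : probability T R)
  (X : T -> 'cV[R]_K).
Hypotheses (mX : random_vector X) (lawX : has_law_std_normal P X).

Lemma expectation_step_ratio s : good_state s ->
  (\int[P]_w (step_ratio s (X w))%:E = 1)%E.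
Proof.
move=> gs; have Sp := filt_cov_posdef gs; have [_ Rp _ _] := gs.
(* The matrix M inside [H] is built from the updated covariance [filt_cov s], so in general it is
   not [pred_cov s]; like it, it is fixed once s is. *)
have Mpos : posdef (st_A s *m filt_cov s *m (st_A s)^T + st_R s).
  exact: posdef_predict.
have [V [lam [VV ME lam0]]] := posdef_spectral Mpos.
pose v := (st_A s *m filt_cov s *m (st_A s)^T + st_R s + 1%:M) *m
  (invmx (pred_cov s + 1%:M) *m st_A s *m st_mu s).
(* With u = 0 the exponential factor is 1, and the list runs over all coordinates. *)
rewrite -[RHS](@expectation_gauss_ratios R d T P K X mX lawX V VV
  (fun i => (V *m v) i ord0) (fun i => Num.sqrt (lam i)) (index_enum 'I_K) (fun=> 0)); last 3 first.
- by move=> i; rewrite gt_eqF// sqrtr_gt0.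
- exact: index_enum_uniq.
- by [].
apply: eq_integral => w _; congr (_%:E).
rewrite /step_ratio (likelihood_ratioE _ _ VV lam0 ME).
rewrite /filt_mean addrK.
rewrite [X in expR (X - _)]big1 => [|i _]; last by rewrite mul0r.
rewrite [X in expR (_ - X / _)]big1 => [|i _]; last by rewrite expr0n.
by rewrite mul0r subrr expR0 mul1r.
Qed.

End expectation.

Section state_measurability.
Context (d : measure_display) (T : measurableType d).

Definition meas_state (s : T -> oga_state R K) : Prop :=
  [/\ mxmeas (fun w => st_mu (s w)), mxmeas (fun w => st_Sigma (s w)),
      mxmeas (fun w => st_A (s w)), mxmeas (fun w => st_R (s w))
    & meas (fun w => st_L (s w)) /\ meas (fun w => st_S (s w))].

Let Qm := @meas_ring_closed R d T.

Lemma meas_pred_cov s : meas_state s -> mxmeas (fun w => pred_cov (s w)).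
Proof.
move=> [_ mS mA mR _]; apply: entrywiseD => //.
by apply: entrywiseM => //; [exact: entrywiseM|exact: entrywiseT].
Qed.

Lemma meas_invP s : meas_state s -> mxmeas (fun w => invmx (pred_cov (s w) + 1%:M)).
Proof.
move=> /meas_pred_cov mP; apply: mxmeas_inv; apply: entrywiseD => //.
exact: entrywise_cst.
Qed.

Lemma meas_filt_cov s : meas_state s -> mxmeas (fun w => filt_cov (s w)).
Proof.
by move=> ms; apply: entrywiseM => //; [exact: meas_pred_cov|exact: meas_invP].
Qed.

Context (s : T -> oga_state R K) (y : T -> 'cV[R]_K).
Hypotheses (ms : meas_state s) (my : mxmeas y).

Lemma meas_filt_mean : mxmeas (fun w => filt_mean (s w) (y w)).
Proof.
have [mmu mS mA mR _] := ms; apply: entrywiseD => //; apply: entrywiseM => //.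
  by apply: entrywiseM => //; exact: meas_invP.
exact: meas_filt_cov.
Qed.

Lemma meas_stepH : meas (fun w =>
  H (st_A (s w)) (st_R (s w)) (filt_cov (s w)) (filt_mean (s w) (y w)) (y w)).
Proof.
have [mmu mS mA mR _] := ms; apply: measurable_H => //.
  exact: meas_filt_cov.
exact: meas_filt_mean.
Qed.

Lemma meas_ln_pdf : meas (fun w => ln (std_normal_pdf (y w))).
Proof.
by apply: (measurableT_comp (@measurable_ln R)); exact: measurable_std_normal_pdf.
Qed.

Lemma meas_step_ratio : meas (fun w => step_ratio (s w) (y w)).
Proof.
apply: (measurableT_comp (@measurable_expR R)).
by apply: measurable_funB; [exact: meas_stepH|exact: meas_ln_pdf].
Qed.

Lemma meas_step (gs : forall w, good_state (s w)) :
  meas_state (fun w => oga_step beta eps A0 R0 (s w) (y w)).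
Proof.
have [mmu mS mA mR [mL mSt]] := ms.
have mlnL : meas (fun w => ln (st_L (s w))).
  exact: (measurableT_comp (@measurable_ln R)).
have mL' : meas (fun w => expR (ln (st_L (s w)) +
    H (st_A (s w)) (st_R (s w)) (filt_cov (s w)) (filt_mean (s w) (y w)) (y w)
    - ln (std_normal_pdf (y w)))).
  apply: (measurableT_comp (@measurable_expR R)).
  apply: measurable_funB; last exact: meas_ln_pdf.
  by apply: measurable_funD => //; exact: meas_stepH.
have mS' : meas (fun w => step_stat (s w) (y w)).
  apply: measurable_funB => //; apply: measurable_funD => //.
  exact: (measurableT_comp (@measurable_ln R)).
have mb : measurable_fun setT (fun w => step_stat (s w) (y w) < 0).
  exact: measurable_fun_ltr.
pose dA w := grad (fun A => H A (st_R (s w)) (filt_cov (s w))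
  (filt_mean (s w) (y w)) (y w)) (st_A (s w)).
have mdA : mxmeas dA.
  move=> i j; rewrite /dA /grad; under eq_fun do rewrite mxE.
  apply: (measurable_derive (f := fun w A => H A (st_R (s w)) (filt_cov (s w))
    (filt_mean (s w) (y w)) (y w))) => // [B mB|w].
    by apply: measurable_H => //; [exact: meas_filt_cov|exact: meas_filt_mean].
  by apply: derivable_H_A; [exact: filt_cov_posdef|have [] := gs w].
pose dR w := sym_grad (fun Rw => H (st_A (s w)) Rw (filt_cov (s w))
  (filt_mean (s w) (y w)) (y w)) (st_R (s w)).
have mdR : mxmeas dR.
  move=> i j; rewrite /dR /sym_grad; under eq_fun do rewrite mxE.
  apply: (measurable_derive (f := fun w Rw => H (st_A (s w)) Rw (filt_cov (s w))
    (filt_mean (s w) (y w)) (y w))) => // [B mB|w].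
    by apply: measurable_H => //; [exact: meas_filt_cov|exact: meas_filt_mean].
  by apply: derivable_H_R; [exact: filt_cov_posdef|have [] := gs w].
have dRT w : (st_R (s w) + beta *: dR w)^T = st_R (s w) + beta *: dR w.
  have [_ [RT _] _ _] := gs w; rewrite linearD linearZ/= RT; congr (_ + _ *: _).
  by apply/matrixP => i j; rewrite !mxE; congr ('D_(2^-1 *: _) _ _); rewrite addrC.
have -> : (fun w => oga_step beta eps A0 R0 (s w) (y w)) = fun w =>
  if step_stat (s w) (y w) < 0 then
    OgaState (filt_mean (s w) (y w)) (filt_cov (s w)) A0 R0 1 0
  else OgaState (filt_mean (s w) (y w)) (filt_cov (s w)) (st_A (s w) + beta *: dA w)
    (Proj eps (st_R (s w) + beta *: dR w))
    (expR (ln (st_L (s w)) +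
    H (st_A (s w)) (st_R (s w)) (filt_cov (s w)) (filt_mean (s w) (y w)) (y w)
    - ln (std_normal_pdf (y w)))) (step_stat (s w) (y w)).
  exact/funext.
have pull (U : Type) (p : oga_state R K -> U) (b : T -> bool) (x z : T -> oga_state R K) :
  (fun w => p (if b w then x w else z w)) = fun w => if b w then p (x w) else p (z w).
  by apply/funext => w; case: ifP.
have mxif m n (b : T -> bool) (F G : T -> 'M[R]_(m, n)) : measurable_fun setT b ->
    mxmeas F -> mxmeas G -> mxmeas (fun w => if b w then F w else G w).
  move=> mb' mF mG i j.
  rewrite /meas (_ : (fun x => _) = fun w => if b w then F w i j else G w i j).
    by apply: measurable_fun_ifT => //; [exact: mF|exact: mG].
  by apply/funext => w; case: ifP.
have mbeta : meas (fun _ : T => beta) by exact: measurable_cst.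
have mA' := entrywiseD Qm mA (entrywiseZ Qm mbeta mdA).
have mR' := measurable_Proj eps dRT (entrywiseD Qm mR (entrywiseZ Qm mbeta mdR)).
split; rewrite ?pull/=.
- exact: (mxif _ _ _ _ _ mb meas_filt_mean meas_filt_mean).
- exact: (mxif _ _ _ _ _ mb (meas_filt_cov ms) (meas_filt_cov ms)).
- exact: (mxif _ _ _ _ _ mb (entrywise_cst Qm A0) mA').
- exact: (mxif _ _ _ _ _ mb (entrywise_cst Qm R0) mR').
- split; rewrite ?pull/=; first exact: (measurable_fun_ifT mb (measurable_cst _) mL').
  exact: (measurable_fun_ifT mb (measurable_cst _) mS').
Qed.

End state_measurability.

End oga.

(* No measurability is assumed: tau_OGA is not shown to be measurable. *)
Lemma ge0_integral_le (R : realType) (d : measure_display) (T : measurableType d)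
    (mu : {measure set T -> \bar R}) (f g : T -> \bar R) :
  (forall x, 0 <= f x)%E -> (forall x, f x <= g x)%E ->
  (\int[mu]_x f x <= \int[mu]_x g x)%E.
Proof.
move=> f0 fg; have g0 x : (0 <= g x)%E by exact: le_trans (fg x).
rewrite !ge0_integralTE//; apply: ub_ereal_sup => _ [h /= hf <-].
apply: ereal_sup_ubound; exists h => //= x; exact: le_trans (hf x) (fg x).
Qed.

(** * Pathwise bounds and measurability along a run *)

Section run.
Context (R : realType) (K : nat) (beta eps : R) (mu0 : 'cV[R]_K)
  (Sigma0 A0 R0 : 'M[R]_K).
Hypotheses (eps_gt0 : 0 < eps) (Sigma0_posdef : posdef Sigma0)
  (R0_posdef : posdef R0).
Implicit Types y : nat -> 'cV[R]_K.

Let run := oga_run beta eps mu0 Sigma0 A0 R0.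

Lemma good_run y t : good_state (run y t).
Proof.
elim: t => [|t IH]; first by split=> //=; rewrite ln1.
exact: good_step.
Qed.

(* The Shiryaev-Roberts statistic. *)
Fixpoint sr y (t : nat) : R :=
  if t is t'.+1 then (1 + sr y t') * step_ratio (run y t') (y t') else 0.

Lemma step_ratio_ge0 (s : oga_state R K) x : 0 <= step_ratio s x.
Proof. exact: expR_ge0. Qed.

Lemma sr_ge0 y t : 0 <= sr y t.
Proof. by elim: t => //= t IH; rewrite mulr_ge0 ?addr_ge0 ?step_ratio_ge0. Qed.

Lemma expR_stat_le_sr y t : expR (st_S (run y t)) <= Num.max 1 (sr y t).
Proof.
elim: t => [|t IH]; first by rewrite /= expR0 le_max lexx.
rewrite [run y t.+1]/= step_statE; last exact: good_run.
rewrite ge_max le_max lexx/= le_max; apply/orP; right.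
rewrite ler_wpM2r ?step_ratio_ge0//; apply: le_trans IH _.
by rewrite ge_max lerDl sr_ge0 lerDr ler01.
Qed.

(** The event tau > t, decided by the first t observations. It holds at t = 0 for every c, in
    accordance with stopping times that start at 1. *)
Fixpoint alive (c : R) y (t : nat) : bool :=
  if t is t'.+1 then alive c y t' && (st_S (run y t'.+1) < c) else true.

(** The sum equals min(n, tau): a lower bound for tau by measurable functions. *)
Lemma sum_alive_le_tau c y n :
  ((\sum_(t < n) (alive c y t)%:R)%:E <= tau_OGA c beta eps mu0 Sigma0 A0 R0 y)%E.
Proof.
apply: le_ereal_inf_tmp => _ [t [t0 ct] <-]; rewrite lee_fin -natr_sum ler_nat.
have dead k : (t <= k)%N -> alive c y k = false.
  elim: k => [|k IH]; first by rewrite leqn0 => /eqP t00; rewrite t00 in t0.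
  rewrite leq_eqVlt => /orP[/eqP tk|/IH/= -> //].
  by rewrite /= -/(run y k.+1) -tk ltNge ct andbF.
have : (\sum_(k < n) alive c y k <= minn n t)%N.
  elim: n => [|n IH]; first by rewrite big_ord0.
  rewrite big_ord_recr/=; have [tn|nt] := leqP t n.
    rewrite dead// addn0 (leq_trans IH)// leq_min geq_minr (leq_trans (geq_minl _ _))//.
  have -> : minn n.+1 t = (minn n t).+1.
    by rewrite (minn_idPl nt) (minn_idPl (ltnW nt)).
  by rewrite -addn1 leq_add// leq_b1.
by move=> /leq_trans; apply; exact: geq_minr.
Qed.

Section measurability.
Context (d : measure_display) (T : measurableType d) (y : nat -> T -> 'cV[R]_K).

(** Only the first t observations have to be measurable, and the sigma-algebra is arbitrary, so the
    lemma also applies to the one generated by the past. *)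
Lemma meas_run t : (forall k, (k < t)%N -> mxmeas (y k)) ->
  meas_state (fun w => run (y ^~ w) t).
Proof.
elim: t => [|t IH] my.
  by split=> /=; [exact: (entrywise_cst (@meas_ring_closed _ _ _))..|split; exact: measurable_cst].
apply: meas_step => //; first by apply: IH => k kt; exact/my/ltnW.
  exact: my.
by move=> w; exact: good_run.
Qed.

Lemma meas_sr t : (forall k, (k < t)%N -> mxmeas (y k)) ->
  meas (fun w => sr (y ^~ w) t).
Proof.
elim: t => [|t IH] my; first exact: measurable_cst.
have my' k : (k < t)%N -> mxmeas (y k) by move=> kt; exact/my/ltnW.
apply: measurable_funM.
  by apply: measurable_funD => //; exact: IH.
by apply: meas_step_ratio; [exact: meas_run|exact: my].
Qed.

Lemma meas_alive c t : (forall k, (k < t)%N -> mxmeas (y k)) ->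
  measurable_fun setT (fun w => alive c (y ^~ w) t).
Proof.
elim: t => [|t IH] my; first exact: measurable_cst.
have [_ _ _ _ [_ mS]] := meas_run my.
apply: measurable_and; first by apply: IH => k kt; exact/my/ltnW.
exact: measurable_fun_ltr.
Qed.

End measurability.

(** * The martingale property and optional stopping *)

Section martingale.
Context (d : measure_display) (T : measurableType d) (P : probability T R)
  (y : nat -> T -> 'cV[R]_K) (y_iid : iid_std_normal P y).

Let my (t : nat) : random_vector (y t). Proof. by have [] := y_iid. Qed.

(** Cylinder events in the first t observations, a pi-system; independence of the next observation
    need only be checked on these. *)
Definition past (t : nat) : set (set T) :=
  [set A | exists2 B : nat -> set 'cV[R]_K, forall k, Borel (B k) &
    A = \bigcap_(k in [set` iota 0 t]) y k @^-1` B k].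

Lemma past_setI t : setI_closed (past t).
Proof.
move=> _ _ [B BB ->] [C CC ->]; exists (fun k => B k `&` C k).
  move=> k; apply: (@measurableI _ (g_sigma_algebraType [set B : set 'cV[R]_K | open B])).
    exact: BB.
  exact: CC.
by rewrite -bigcapI.
Qed.

Lemma Borel_setT : Borel [set: 'cV[R]_K].
Proof. exact: (@measurableT _ (g_sigma_algebraType [set B : set 'cV[R]_K | open B])). Qed.

Lemma past_setT t : past t setT.
Proof.
exists (fun=> setT) => [_|]; first exact: Borel_setT.
by apply/seteqP; split.
Qed.

Lemma past_measurable t : past t `<=` measurable.
Proof.
move=> _ [B BB ->]; apply: fin_bigcap_measurable; first exact: finite_seq.
by move=> k _; exact: my.
Qed.

Lemma past_indep t A (C : set 'cV[R]_K) : past t A -> Borel C ->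
  P (A `&` y t @^-1` C) = (P A * P (y t @^-1` C))%E.
Proof.
have [_ _ ind] := y_iid; move=> [B BB ->] BC.
rewrite ind ?iota_uniq//.
pose B' k := if k == t then C else B k.
have := ind (iota 0 t.+1) B' (iota_uniq _ _).
rewrite -[t.+1]addn1 iotaD big_cat/= big_seq1 add0n {4}/B' eqxx => E.
rewrite (eq_big_seq (fun k => P (y k @^-1` B' k))) => [|k]; last first.
  by rewrite mem_iota add0n /= /B' => kt; rewrite ltn_eqF.
rewrite -E; last by move=> k _; rewrite /B'; case: ifP.
congr (P _); apply/seteqP; split=> w /=.
  move=> [h1 h2] k /=; rewrite mem_cat mem_seq1 => kt.
  rewrite /B'; case: eqVneq => [->//|nkt]; apply: h1.
  by move: kt; rewrite (negbTE nkt) orbF.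
move=> h; split; last first.
  by have := h t; rewrite /B' eqxx /= mem_cat mem_seq1 eqxx orbT; apply.
move=> k /= kt; have := h k; rewrite /= mem_cat kt /= /B' => /(_ isT).
by rewrite ltn_eqF//; move: kt; rewrite mem_iota.
Qed.

Lemma meas_past k t : (k < t)%N ->
  @mxmeas R _ (g_sigma_algebraType (past t)) K 1 (y k).
Proof.
move=> kt i j; rewrite (ord1 j) => _ C mC; rewrite setTI.
apply: sub_sigma_algebra.
exists (fun l => if l == k then [set x : 'cV[R]_K | C (x i ord0)] else setT).
  by move=> l; case: ifP => _; [exact: Borel_coord|exact: Borel_setT].
apply/seteqP; split=> w /=.
  by move=> Cw l _ /=; case: eqVneq => [->|].
by move=> /(_ k) /=; rewrite mem_iota add0n eqxx; apply.
Qed.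

(** Conditional mean 1 of the step ratio, tested against nonnegative weights known at time t; it
    also covers weights of infinite mean. *)
Lemma expectation_past_step_ratio t (g : T -> R) :
  @meas R _ (g_sigma_algebraType (past t)) g -> (forall w, 0 <= g w) ->
  (\int[P]_w (g w * step_ratio (run (y ^~ w) t) (y t w))%:E =
   \int[P]_w (g w)%:E)%E.
Proof.
move=> mg g0.
pose TB := g_sigma_algebraType [set B : set 'cV[R]_K | open B].
pose TP := g_sigma_algebraType (past t).
(* The past enters as the identity into [TP]: the whole run up to t is a function of the first
   component and the new observation is the second. *)
pose f (z : TP * TB) : \bar R :=
  (g z.1 * step_ratio (run (y ^~ z.1) t) z.2)%:E.
have mf : measurable_fun setT f.
  apply/measurable_EFinP; apply: measurable_funM.
    exact: (measurableT_comp mg).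
  apply: meas_step_ratio; last first.
    move=> i j; rewrite (ord1 j).
    have mc : measurable_fun setT (fun x : TB => x i ord0 : R).
      by move=> _ C mC; rewrite setTI; exact: Borel_coord.
    exact: (measurableT_comp mc).
  apply: (@meas_run _ (TP * TB)%type (fun k z => y k z.1)) => k kt i j.
  exact: (measurableT_comp (meas_past kt i j)).
have f0 z : (0 <= f z)%E by rewrite lee_fin mulr_ge0// step_ratio_ge0.
have myt : measurable_fun setT (y t : T -> TB).
  by move=> _ C mC; rewrite setTI; exact: my.
have ind A C : <<s past t >> A -> Borel C ->
    P (A `&` y t @^-1` C) = (P A * P (y t @^-1` C))%E.
  move=> sA mC; apply: (@indep_g_sigma _ _ _ _ (past t)) => //.
  - exact: past_setI.
  - exact: past_setT.
  - exact: past_measurable.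
  - exact: my.
  - by move=> B /= bB; exact: past_indep.
have := @integral_indep R d T P _ _ TP TB id (y t) f
  (measurable_id_g_sigma (@past_measurable t)) myt ind mf f0.
rewrite /f/= => ->; apply: eq_integral => w _.
have gs := good_run (y ^~ w) t.
have [_ law _] := y_iid.
have mE : measurable_fun setT (fun w' => (step_ratio (run (y ^~ w) t) (y t w'))%:E).
  apply/measurable_EFinP; apply: meas_step_ratio.
    by split=> /=; [exact: (entrywise_cst (@meas_ring_closed _ _ _))..|split; exact: measurable_cst].
  by move=> i j; rewrite (ord1 j); exact: random_vector_coord.
transitivity ((g w)%:E * \int[P]_w' (step_ratio (run (y ^~ w) t) (y t w'))%:E)%E.
  rewrite -ge0_integralZl//; first by move=> x _; rewrite lee_fin step_ratio_ge0.
  by rewrite lee_fin.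
by rewrite (expectation_step_ratio (my t) (law t) gs) mule1.
Qed.

Let mxy t : mxmeas (y t).
Proof. by move=> i j; rewrite (ord1 j); exact: random_vector_coord. Qed.

Let past_alive c t :
  @measurable_fun _ _ (g_sigma_algebraType (past t)) bool setT
    (fun w => alive c (y ^~ w) t).
Proof. by apply: meas_alive => k kt; exact: meas_past. Qed.

(* Both sides have moved terms so that no subtraction of extended reals occurs
   after integration. When the run stops at t+1 this is sr t.+1 >= expR c. *)
Lemma sr_alive_le (c : R) (z : nat -> 'cV[R]_K) t : 0 < c ->
  expR c * (alive c z t)%:R + sr z t.+1 * (alive c z t.+1)%:R <=
  expR c * (alive c z t.+1)%:R + sr z t.+1 * (alive c z t)%:R.
Proof.
move=> c0; have := expR_stat_le_sr z t.+1; have := sr_ge0 z t.+1.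
rewrite [alive c z t.+1]/= -/(run z t.+1); move: (sr z t.+1) => D D0 SD.
case: (alive c z t) => /=; last by rewrite !mulr0.
have [_|cS] := ltP; first by [].
rewrite !mulr0 !mulr1 addr0 add0r.
have : expR c <= Num.max 1 D by apply: le_trans SD; rewrite ler_expR.
by rewrite le_max leNgt -{1}expR0 ltr_expR c0.
Qed.

(** With D the Shiryaev-Roberts statistic, [p c t] is P(tau > t), and [q c t] below is the mean of
    D_t on that event. *)
Let p c t : \bar R := (\int[P]_w (alive c (y ^~ w) t)%:R%:E)%E.
Let q c t : \bar R :=
  (\int[P]_w (sr (y ^~ w) t * (alive c (y ^~ w) t)%:R)%:E)%E.

Let malive c t : measurable_fun setT (fun w => (alive c (y ^~ w) t)%:R : R).
Proof.
have mb : measurable_fun setT (fun w => alive c (y ^~ w) t).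
  by apply: meas_alive.
rewrite (_ : (fun _ => _) = fun w => if alive c (y ^~ w) t then 1 else 0).
  by apply: measurable_fun_ifT.
by apply/funext => w; case: ifP.
Qed.

Let malive' c t : @meas R _ (g_sigma_algebraType (past t))
  (fun w => (alive c (y ^~ w) t)%:R : R).
Proof.
have mb := @past_alive c t.
rewrite (_ : (fun _ => _) = fun w => if alive c (y ^~ w) t then 1 else 0).
  by apply: measurable_fun_ifT.
by apply/funext => w; case: ifP.
Qed.

Let msr t : measurable_fun setT (fun w => sr (y ^~ w) t).
Proof. by apply: meas_sr. Qed.

(** The event tau > t is known at time t, so the mean of D_{t+1} on it is [q c t + p c t]; the rest
    is the integral of the pathwise inequality [sr_alive_le]. *)
Lemma stopped_step c t : 0 < c ->
  ((expR c)%:E * p c t + q c t.+1 <= (expR c)%:E * p c t.+1 + (q c t + p c t))%E.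
Proof.
move=> c0.
have mD1 s : measurable_fun setT (fun w => (expR c * (alive c (y ^~ w) s)%:R)%:E).
  by apply/measurable_EFinP; exact: measurable_funM.
have mD2 r s : measurable_fun setT (fun w => (sr (y ^~ w) r * (alive c (y ^~ w) s)%:R)%:E).
  by apply/measurable_EFinP; exact: measurable_funM.
have D10 s w : (0 <= (expR c * (alive c (y ^~ w) s)%:R)%:E)%E.
  by rewrite lee_fin mulr_ge0 ?expR_ge0.
have D20 r s w : (0 <= (sr (y ^~ w) r * (alive c (y ^~ w) s)%:R)%:E)%E.
  by rewrite lee_fin mulr_ge0 ?sr_ge0.
have pE s : ((expR c)%:E * p c s = \int[P]_w (expR c * (alive c (y ^~ w) s)%:R)%:E)%E.
  rewrite /p -ge0_integralZl//; exact/measurable_EFinP.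
have qE : (\int[P]_w (sr (y ^~ w) t.+1 * (alive c (y ^~ w) t)%:R)%:E = q c t + p c t)%E.
  transitivity (\int[P]_w ((1 + sr (y ^~ w) t) * (alive c (y ^~ w) t)%:R *
      step_ratio (run (y ^~ w) t) (y t w))%:E)%E.
    by apply: eq_integral => w _; rewrite /= mulrAC.
  rewrite (@expectation_past_step_ratio t
    (fun w => (1 + sr (y ^~ w) t) * (alive c (y ^~ w) t)%:R)); last 2 first.
  - apply: measurable_funM; last exact: malive'.
    apply: measurable_funD; first exact: measurable_cst.
    by apply: meas_sr => k kt; exact: meas_past.
  - by move=> w; rewrite mulr_ge0 ?addr_ge0 ?sr_ge0.
  rewrite /q /p -ge0_integralD//; last by apply/measurable_EFinP.
  by apply: eq_integral => w _; rewrite -EFinD mulrDl mul1r addrC.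
rewrite -qE !pE /q -!ge0_integralD//.
apply: ge0_integral_le => w; first by rewrite adde_ge0.
by rewrite -!EFinD lee_fin sr_alive_le.
Qed.

Let p0 c : p c 0 = 1%E.
Proof.
by rewrite /p; apply: etrans (integral_cst _ measurableT 1%E) _;
   rewrite [X in (_ * X)%E]probability_setT mul1e.
Qed.

(** Telescoping of [stopped_step] from D_0 = 0 and P(tau > 0) = 1. Finiteness is carried through the
    induction so that the terms can be cancelled in [R]. *)
Lemma stopped_sum c n : 0 < c ->
  (q c n \is a fin_num) /\ (forall t, p c t \is a fin_num) /\
  expR c + fine (q c n) <= expR c * fine (p c n) + \sum_(t < n) fine (p c t).
Proof.
move=> c0.
have pge0 t : (0 <= p c t)%E by apply: integral_ge0 => w _; rewrite lee_fin.
have qge0 t : (0 <= q c t)%E.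
  by apply: integral_ge0 => w _; rewrite lee_fin mulr_ge0 ?sr_ge0.
have pf t : p c t \is a fin_num.
  rewrite ge0_fin_numE// (@le_lt_trans _ _ 1%E) ?ltry// -(p0 c).
  apply: ge0_integral_le => w; rewrite ?lee_fin//.
  by rewrite ler_nat leq_b1.
elim: n => [|n [qf [_ IH]]].
  have q0 : q c 0 = 0%E.
    by rewrite /q /=; under eq_integral do rewrite mul0r; rewrite integral0.
  by rewrite q0 p0 big_ord0 /= mulr1 !addr0.
have H := stopped_step n c0.
have qf' : q c n.+1 \is a fin_num.
  rewrite ge0_fin_numE//; apply: (@le_lt_trans _ _ ((expR c)%:E * p c n + q c n.+1)%E).
    by rewrite leeDr// mule_ge0// lee_fin expR_ge0.
  apply: le_lt_trans (stopped_step n c0) _.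
  by rewrite -(fineK (pf n)) -(fineK (pf n.+1)) -(fineK qf) -EFinM -!EFinD ltry.
split=> //; split=> //.
move: H; rewrite -(fineK (pf n)) -(fineK (pf n.+1)) -(fineK qf) -(fineK qf').
rewrite -!EFinM -!EFinD lee_fin /= => H.
rewrite big_ord_recr/=; lra.
Qed.

(** If E tau were r < [expR c], monotonicity would give n P(tau > n) <= r, so the term [expR c] *
    P(tau > n) in [stopped_sum] would vanish in the limit and leave [expR c] <= r. *)
Lemma expectation_tau_ge c : 0 < c ->
  ((expR c)%:E <=
   \int[P]_w tau_OGA c beta eps mu0 Sigma0 A0 R0 (fun t => y t w))%E.
Proof.
move=> c0; set s := (\int[P]_w _)%E.
have pge0 t : (0 <= p c t)%E by apply: integral_ge0 => w _; rewrite lee_fin.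
have pf t : p c t \is a fin_num by have [_ []] := stopped_sum 0 c0.
have sum_le n : ((\sum_(t < n) fine (p c t))%:E <= s)%E.
  rewrite -sumEFin (eq_bigr (fun t : 'I_n => p c t)) => [|t _]; last by rewrite fineK.
  rewrite /p -ge0_integral_sum//; last by move=> t; apply/measurable_EFinP.
  apply: ge0_integral_le => w; first by apply: sume_ge0 => t _; rewrite lee_fin.
  by rewrite sumEFin sum_alive_le_tau.
have antitone t u : (t <= u)%N -> fine (p c u) <= fine (p c t).
  move=> tu; rewrite fine_le//; apply: ge0_integral_le => w; rewrite lee_fin// ler_nat.
  elim: u tu => [|u IH]; first by rewrite leqn0 => /eqP->.
  rewrite leq_eqVlt => /orP[/eqP->//|/IH h]; apply: leq_trans _ h.
  by rewrite /=; case: (alive c _ u); rewrite /= ?leq_b1.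
have np_le n : n%:R * fine (p c n) <= \sum_(t < n) fine (p c t).
  rewrite -[n in n%:R]card_ord -sum1_card natr_sum mulr_suml; apply: ler_sum => t _.
  by rewrite mul1r antitone// ltnW.
have s0 : (0 <= s)%E by apply: le_trans (sum_le 0%N); rewrite big_ord0.
case: s s0 sum_le => [r| |]// r0 sum_le; last by rewrite leey.
rewrite lee_fin leNgt; apply/negP => rc.
(* With g = [expR c] and m = n + 1, the bounds g <= g p_m + r and m p_m <= r give m (g - r) <= g r,
   which this n violates. *)
have [n nE] : exists n : nat, expR c * r / (expR c - r) < n.+1%:R.
  exists (Num.bound (expR c * r / (expR c - r))).
  apply: lt_le_trans (archi_boundP _) _; last by rewrite ler_nat.
  by rewrite divr_ge0 ?mulr_ge0 ?expR_ge0 ?subr_ge0 ?(ltW rc).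
have [_ [_ H]] := stopped_sum n.+1 c0.
have q0 : 0 <= fine (q c n.+1).
  by apply: fine_ge0; apply: integral_ge0 => w _; rewrite lee_fin mulr_ge0 ?sr_ge0.
have := sum_le n.+1; rewrite lee_fin => sr.
have := np_le n.+1; move: H sr q0 nE; set S := \sum_(t < _) _; set pn := fine (p c _).
rewrite ltr_pdivrMr ?subr_gt0//; have := expR_gt0 c; move: (expR c) rc => g rc g0.
have : (1 : R) <= n.+1%:R by rewrite ler1n.
set m := n.+1%:R; move=> m1 H Sr q0 nE mp.
have H1 : g <= g * pn + r by lra.
have H2 : m * pn <= r by lra.
have : m * g <= g * (m * pn) + m * r.
  by rewrite mulrCA -mulrDr ler_wpM2l//; lra.
have : g * (m * pn) <= g * r by rewrite ler_wpM2l// ltW.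
lra.
Qed.

End martingale.
End run.

Theorem theorem7 (R : realType) (K : nat) (d : measure_display)
    (T : measurableType d) (Pinf : probability T R)
    (y : nat -> T -> 'cV[R]_K)
    (gamma beta eps : R)
    (mu0 : 'cV[R]_K) (Sigma0 A0 R0 : 'M[R]_K)
    (K_gt0 : (0 < K)%N) (gamma_gt0 : 0 < gamma) (eps_gt0 : 0 < eps)
    (Sigma0_posdef : posdef Sigma0) (R0_posdef : posdef R0)
    (y_iid : iid_std_normal Pinf y) :
  (gamma%:E <=
   \int[Pinf]_w
     tau_OGA (ln gamma) beta eps mu0 Sigma0 A0 R0 (fun t => y t w))%E.
Proof.
have [gamma_le1|gamma_gt1] := leP gamma 1.
  apply: (@le_trans _ _ (\int[Pinf]_w (cst 1 w))%E).
    rewrite (integral_cst _ measurableT 1%E) [X in (_ * X)%E]probability_setT.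
    by rewrite mule1 lee_fin.
  apply: ge0_integral_le => w //.
  apply: le_ereal_inf_tmp => _ [t [t0 _] <-].
  by rewrite lee_fin ler1n.
rewrite -{1}(lnK (gamma_gt0 : gamma \is Num.pos)).
by apply: expectation_tau_ge => //; rewrite ln_gt0.
Qed.
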